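(* There is a universal constant $C>0$ such that the following holds. Let $\alpha>0$, $p\ge 1$, $\tau_0>0$, $0<\omega<1$, let $L>0$ satisfy $L\ge\sqrt{\tau_0}$, let $n$ be an even positive integer with $L/(n\sqrt{\tau_0})<1$, and let $M\ge 0$ be an integer. Let $Z[j_1,j_2]$, $0\le j_1,j_2\le n-1$, be independent, zero-mean sub-Gaussian real random variables with sub-Gaussian norms $\sigma[j_1,j_2]=\|Z[j_1,j_2]\|_{\psi_2}$, and suppose $$\frac{1}{n^2}\sum_{j_1=0}^{n-1}\sum_{j_2=0}^{n-1}\sigma[j_1,j_2]^2\le\sigma^2,$$ where $\sigma>0$. Then the random variable $\Pi_n=\|Z\|_{\gamma_p^\alpha}$ satisfies $$\|\Pi_n\|_{\psi_2}\ \le\ C\cdot\frac{\tau_0^{\alpha/2}}{1-\omega^{1/2}}\cdot L\cdot\sqrt{p}\cdot\sigma\cdot\Delta_{\alpha,p}\big(L/(n\sqrt{\tau_0})\big).$$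
   Context: Sub-Gaussian norm: $\|X\|_{\psi_2}=\inf\{t>0:\mathbb{E}\,e^{|X|^2/t^2}\le 2\}$. Discrete norm $\|\cdot\|_{\gamma_p^\alpha}$: let $t_j=-L/2+Lj/n$, $j=0,\dots,n-1$ (the grid for the square of side $L$ centered at the origin). For an array $x=(x[j_1,j_2])_{0\le j_1,j_2\le n-1}$ define, with $i=\sqrt{-1}$, $$\widehat{x}[k_1,k_2]=\frac{L^2}{n^2}\sum_{j_1=0}^{n-1}\sum_{j_2=0}^{n-1}x[j_1,j_2]\,e^{-2\pi i(k_1t_{j_1}+k_2t_{j_2})/L},$$ $$\widehat{G}_\tau(\xi_1,\xi_2)=e^{-\pi^2\tau(\xi_1^2+\xi_2^2)},\qquad \widehat{x}_\tau[k_1,k_2]=\widehat{x}[k_1,k_2]\,\widehat{G}_\tau(k_1/L,k_2/L),$$ $$S(\tau)^2=\frac{1}{L^2}\sum_{k_1=-n/2}^{n/2-1}\sum_{k_2=-n/2}^{n/2-1}|\widehat{x}_\tau[k_1,k_2]|^2,\quad S(\tau)\ge 0.$$ With $\tau_\ell=\tau_0\omega^\ell$ and a number of levels given by $M$, $$\|x\|_{\gamma_p^\alpha}=\Big(\sum_{\ell=0}^{M}\tau_\ell^{p\alpha/2}S(\tau_\ell)^p\Big)^{1/p}.$$ The function $\Delta_{\alpha,p}$: for $0<\epsilon<1$, $$\Delta_{\alpha,p}(\epsilon)=\begin{cases}\epsilon^\alpha/(\alpha-\alpha^2)^{1/p}, & 0<\alpha<1,\\ \epsilon\,(\log(1/\epsilon)+1)^{1/p},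 & \alpha=1,\\ \epsilon/\min\{(\alpha-1)^{1/p},1\}, & \alpha>1.\end{cases}$$ *)

(* Defs.v *)
From mathcomp Require Import all_boot all_order all_algebra.
From mathcomp Require Import complex.
From mathcomp Require Import all_classical all_reals all_analysis.

Set Implicit Arguments.
Unset Strict Implicit.
Unset Printing Implicit Defensive.

Import Order.TTheory GRing.Theory Num.Theory.
Import numFieldNormedType.Exports.

Local Open Scope classical_set_scope.
Local Open Scope ring_scope.

(* Equal to +oo (the infimum of the empty set) exactly when X is not
   sub-Gaussian, so that a finite value entails sub-Gaussianity. *)
Definition psi2_norm {d} {T : measurableType d} {R : realType}
    (P : probability T R) (X : T -> R) : \bar R :=
  ereal_inf [set t%:E | t in
    [set t | 0 < t /\ ('E_P[fun w => expR (`|X w| ^+ 2 / t ^+ 2)] <= 2%:E)%E]].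

Definition mutually_independent {d} {T : measurableType d} {R : realType}
    (P : probability T R) {I : finType} (X : I -> {RV P >-> R}) : Prop :=
  forall (J : {set I}) (B : I -> set R),
    (forall i, i \in J -> measurable (B i)) ->
    P (\bigcap_(i in [set` J]) (X i @^-1` B i))
      = (\prod_(i in J) P (X i @^-1` B i))%E.

Section discrete_norm.
Context {R : realType}.

Definition cis (theta : R) : R[i] := Complex (cos theta) (sin theta).

Variables (L : R) (n : nat).

Definition grid (j : 'I_n) : R := - L / 2 + L * j%:R / n%:R.

Definition dft (x : 'I_n -> 'I_n -> R[i]) (k1 k2 : int) : R[i] :=
  real_complex R (L ^+ 2 / n%:R ^+ 2) *
  \sum_(j1 < n) \sum_(j2 < n)
    x j1 j2 *
    cis (- 2 * pi * (k1%:~R * grid j1 + k2%:~R * grid j2) / L).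

Definition gauss_hat (tau xi1 xi2 : R) : R :=
  expR (- pi ^+ 2 * tau * (xi1 ^+ 2 + xi2 ^+ 2)).

Definition dft_smooth (x : 'I_n -> 'I_n -> R[i]) (tau : R) (k1 k2 : int) :
    R[i] :=
  dft x k1 k2 * real_complex R (gauss_hat tau (k1%:~R / L) (k2%:~R / L)).

(* For even n, the values freq m with m < n are exactly the integers
   - n / 2, ..., n / 2 - 1. *)
Definition freq (m : 'I_n) : int := m%:Z - (n./2)%:Z.

(* normc is the R-valued modulus; the norm `|_| of R[i] is R[i]-valued. *)
Definition smooth_norm (x : 'I_n -> 'I_n -> R[i]) (tau : R) : R :=
  Num.sqrt (L ^- 2 *
    \sum_(m1 < n) \sum_(m2 < n)
      ComplexField.Normc.normc (dft_smooth x tau (freq m1) (freq m2)) ^+ 2).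

Definition gamma_norm (p alpha tau0 omega : R) (M : nat)
    (x : 'I_n -> 'I_n -> R[i]) : R :=
  let tau (l : nat) := tau0 * omega ^+ l in
  (\sum_(l < M.+1)
     tau l `^ (p * alpha / 2) * smooth_norm x (tau l) `^ p) `^ p^-1.

End discrete_norm.

Definition Delta {R : realType} (alpha p eps : R) : R :=
  if alpha < 1 then eps `^ alpha / (alpha - alpha ^+ 2) `^ p^-1
  else if alpha == 1 then eps * (ln eps^-1 + 1) `^ p^-1
  else eps / Num.min ((alpha - 1) `^ p^-1) 1.

(* Main.v *)
Require Import Defs.
From HB Require Import structures.
From mathcomp Require Import all_boot all_order all_algebra.
From mathcomp Require Import complex.
From mathcomp Require Import all_classical all_reals all_analysis.
From mathcomp Require Import measurable_realfun.
From mathcomp Require Import ring lra.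

(** With r = omega^(1/2) and eps = L / (n tau0^(1/2)), S(tau) is the norm of a
    sum of independent vectors Z_j v_j in a Euclidean space, all v_j having the
    same norm, at most 8 (L/n) mu with mu = min(1, L / (n tau^(1/2))), by
    comparison of a Gaussian sum with a telescoping sum.

    Integrating out one variable at a time gives, for lam D < 1 and
    D = 48 sum_j t_j^2 |v_j|^2 with t_j slightly above the norm of Z_j,
    E exp(lam |sum_j Z_j v_j|^2) <= 1 / (1 - lam D): removing Z_m replaces lam
    by lam / (1 - 48 lam t_m^2 |v_m|^2) and costs the factor
    1 / (1 - 48 lam t_m^2 |v_m|^2), independently of the dimension.  Hence
    S(tau_l) has sub-Gaussian norm O(L sigma min(1, eps r^-l)).

    The l^p combination over the levels costs a factor sqrt (5 p), because
    s |-> exp(s^(2/p)) is convex where s^(2/p) >= p / 2.  It remains to sum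
    r^(alpha p l) min(1, eps r^-l)^p, split at r^l = eps. *)

Set Implicit Arguments.
Unset Strict Implicit.
Unset Printing Implicit Defensive.

Import Order.TTheory GRing.Theory Num.Theory.
Import numFieldNormedType.Exports.

Local Open Scope classical_set_scope.
Local Open Scope ring_scope.

(** * Convexity inequalities for the exponential *)

Section real_inequalities.
Context {R : realType}.
Implicit Types x a u v q r eps b : R.

(** For a centred variable the linear term integrates to zero, leaving only a square in the
    exponent. When [x <= 1/2], [expR x <= 1 / (1 - x) <= 1 + x + 2 * x ^+ 2]; otherwise
    [x <= 2 * x ^+ 2]. *)
Lemma expR_le_add_expR_sqr x : expR x <= x + expR (2 * x ^+ 2).
Proof.
have [hx|hx] := leP x (1 / 2).
  apply: (@le_trans _ _ (1 + x + 2 * x ^+ 2)); last first.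
    by have := expR_ge1Dx (2 * x ^+ 2); lra.
  rewrite -[x in expR x]opprK expRN -[leRHS]invrK lef_pV2 ?posrE ?expR_gt0 //.
    apply: le_trans (expR_ge1Dx (- x)).
    rewrite -div1r ler_pdivrMr; last nra.
    have : 0 <= x ^+ 2 * (1 - 2 * x) by apply: mulr_ge0; [exact: sqr_ge0|lra].
    lra.
  by rewrite invr_gt0; nra.
apply: le_trans (_ : expR (2 * x ^+ 2) <= _); last lra.
by rewrite ler_expR; nra.
Qed.

(** Convexity from the tangent line at [a * x], taken at [x] and at [0] with weights [a] and
    [1 - a], so that the linear terms cancel. *)
Lemma expR_chord a x : 0 <= a <= 1 -> expR (a * x) <= 1 + a * (expR x - 1).
Proof.
move=> /andP[a0 a1].
have h1 : expR (a * x) * (1 + (1 - a) * x) <= expR x.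
  have -> : expR x = expR (a * x) * expR ((1 - a) * x).
    by rewrite -expRD; congr expR; ring.
  by rewrite ler_wpM2l ?expR_ge0 ?expR_ge1Dx.
have h2 : expR (a * x) * (1 - a * x) <= 1.
  rewrite [leRHS](_ : _ = expR (a * x) * expR (- (a * x))); last by rewrite -expRD subrr expR0.
  by rewrite ler_wpM2l ?expR_ge0 ?expR_ge1Dx.
have := ler_wpM2l a0 h1.
have a1' : 0 <= 1 - a by rewrite subr_ge0.
have := ler_wpM2l a1' h2.
nra.
Qed.

Lemma powR_bernoulli_le a x : 0 <= x -> 0 <= a <= 1 -> x `^ a <= 1 + a * (x - 1).
Proof.
rewrite le_eqVlt => /predU1P[<-|x0] a01.
  (* At [x = 0] the exponent [0] is separate: the power is then 1, and 0 for every other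
     exponent. *)
  have [->|a0] := eqVneq a 0; first by rewrite powRr0; lra.
  by rewrite powR0 //; case/andP: a01; lra.
rewrite /powR gt_eqF //.
by have := expR_chord (ln x) a01; rewrite lnK.
Qed.

Lemma powR_bernoulli_ge a x : 0 <= x -> 1 <= a -> 1 + a * (x - 1) <= x `^ a.
Proof.
move=> x0 a1; have a0 : 0 < a by lra.
have : 0 <= a^-1 <= 1 by rewrite invr_ge0 ltW //= invf_le1.
move=> /(powR_bernoulli_le (powR_ge0 x a)).
rewrite -powRrM divff ?gt_eqF // powRr1 // => h.
have := ler_wpM2l (ltW a0) h.
by rewrite mulrDr mulrA divff ?gt_eqF //; lra.
Qed.

(* The tangent inequality at [u ^ q] of the convex part of
   [s |-> expR (s ^ (1 / q))], which starts at [s ^ (1 / q) = q]. *)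
Lemma expR_tangent_powR q u v : 0 < q -> q <= u -> 0 <= v ->
  expR u * (1 + u / q * ((v / u) `^ q - 1)) <= expR v.
Proof.
move=> q0 qu v0; have u0 : 0 < u by lra.
have vu0 : 0 <= v / u by rewrite divr_ge0 // ltW.
have -> : expR v = expR u * expR (u * (v / u - 1)).
  by rewrite -expRD; congr expR; rewrite mulrBr mulrCA divff ?gt_eqF //; ring.
rewrite ler_wpM2l ?expR_ge0 //.
have h1 : 1 <= u / q by rewrite ler_pdivlMr ?mul1r.
apply: le_trans (powR_bernoulli_ge (powR_ge0 _ _) h1) _.
rewrite -powRrM mulrCA divff ?gt_eqF // mulr1.
have : (v / u) `^ u <= expR (v / u - 1) `^ u.
  rewrite ge0_ler_powR ?nnegrE ?expR_ge0 ?(ltW u0) //.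
  by apply: le_trans (expR_ge1Dx _); rewrite addrC subrK.
by move=> /le_trans; apply; rewrite -expRM mulrC.
Qed.

(** A Jensen inequality for [s |-> expR (s ^ (1 / q))], which need not be convex near 0. Below [q]
    the extra term [expR q] suffices; for [u >= q] the tangents at [u ^ q] are averaged, and their
    linear parts cancel because [u ^ q] is the mean of the [v i ^ q]. *)
Lemma expR_pmean (I : finType) (w v : I -> R) q u :
  0 < q -> 0 <= u -> (forall i, 0 <= w i) -> (forall i, 0 <= v i) ->
  \sum_i w i = 1 -> u `^ q = \sum_i w i * v i `^ q ->
  expR u <= expR q + \sum_i w i * expR (v i).
Proof.
move=> q0 u0 w0 v0 w1 uE.
have sum0 : 0 <= \sum_i w i * expR (v i).
  by apply: sumr_ge0 => i _; rewrite mulr_ge0 ?expR_ge0.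
have [uq|qu] := ltP u q.
  apply: le_trans (_ : expR q <= _); first by rewrite ler_expR ltW.
  by rewrite lerDl.
have {}u0 : 0 < u by lra.
apply: le_trans (_ : \sum_i w i * expR (v i) <= _); last first.
  by rewrite lerDr expR_ge0.
have : \sum_i w i * (expR u * (1 + u / q * ((v i / u) `^ q - 1)))
    <= \sum_i w i * expR (v i).
  apply: ler_sum => i _; rewrite ler_wpM2l //; exact: expR_tangent_powR.
apply: le_trans; rewrite le_eqVlt; apply/orP; left; apply/eqP.
transitivity (expR u * ((1 - u / q) * \sum_i w i +
    u / q * (u `^ q)^-1 * \sum_i w i * v i `^ q)).
  rewrite w1 -uE -mulrA mulVf; first by ring.
  by rewrite gt_eqF ?powR_gt0.
rewrite !mulr_sumr -big_split /= mulr_sumr; apply: eq_bigr => i _.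
rewrite powRM ?invr_ge0 ?(ltW u0) // -(powR_inv1 (ltW u0)) -powRrM mulN1r powRN.
ring.
Qed.

End real_inequalities.

(** * Geometric sums over the levels *)

Section level_sums.
Context {R : realType}.
Implicit Types a b c r q eps x : R.

(** Trades every geometric denominator [1 - r ^ a] for [1 - r]: [r ^ a <= r] when [a >= 1], and
    Bernoulli's inequality otherwise. *)
Lemma one_sub_powR_ge r a : 0 < r < 1 -> 0 < a ->
  Num.min 1 a * (1 - r) <= 1 - r `^ a.
Proof.
move=> /andP[r0 r1] a0; have [a1|a1] := leP 1 a.
  rewrite mul1r lerD2l lerN2.
  by apply: ge1r_powR => //; rewrite r0 ltW.
have := @powR_bernoulli_le R a r; rewrite (ltW r0) (ltW a0) (ltW a1).
by move=> /(_ isT isT); lra.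
Qed.

Lemma powR_le1 a c : 0 <= a <= 1 -> 0 <= c -> a `^ c <= 1.
Proof.
move=> /andP[a0 a1] c0; rewrite [leRHS](_ : _ = 1 `^ c); last by rewrite powR1.
by rewrite ge0_ler_powR ?nnegrE.
Qed.

Lemma powR_ge1 a c : 1 <= a -> 0 <= c -> 1 <= a `^ c.
Proof.
move=> a1 c0; rewrite [leLHS](_ : _ = 1 `^ c); last by rewrite powR1.
by rewrite ge0_ler_powR ?nnegrE // (le_trans ler01).
Qed.

Lemma geometric_sum_le q N : 0 <= q < 1 -> \sum_(l < N) q ^+ l <= (1 - q)^-1.
Proof.
move=> /andP[q0 q1]; rewrite -[leRHS]mul1r ler_pdivlMr ?subr_gt0 //.
elim: N => [|N IH]; first by rewrite big_ord0; lra.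
rewrite big_ord_recl /= expr0.
under eq_bigr do rewrite /bump /= add1n exprS.
rewrite -mulr_sumr; move: IH; set S := \sum_(_ < _) _; nra.
Qed.

Lemma powR_exp r a l : 0 <= r -> (r ^+ l) `^ a = (r `^ a) ^+ l.
Proof. by move=> r0; rewrite -powR_mulrn // powRAC powR_mulrn ?powR_ge0. Qed.

Lemma powR_itv01 r a : 0 < r < 1 -> 0 < a -> 0 < r `^ a < 1.
Proof.
move=> /andP[r0 r1] a0; rewrite powR_gt0 //=.
rewrite [ltRHS](_ : _ = 1 `^ a); last by rewrite powR1.
by rewrite gt0_ltr_powR ?nnegrE ?ler01 ?(ltW r0).
Qed.

(** Induction on the number of levels with [eps] free: for [eps <= 1] level 0 is absent, and
    shifting the index replaces [eps] by [eps / r], under which the bound scales exactly. For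
    [eps > 1] the full geometric series is enough. *)
Lemma geometric_tail_le r c eps N : 0 < r < 1 -> 0 < c -> 0 < eps ->
  \sum_(l < N | r ^+ l < eps) (r ^+ l) `^ c <= eps `^ c / (1 - r `^ c).
Proof.
move=> r01 c0; have /andP[q0 q1] := powR_itv01 r01 c0.
have /andP[r0 r1] := r01.
elim: N eps => [|N IH] eps e0.
  by rewrite big_ord0 divr_ge0 ?powR_ge0 //; lra.
have [e1|e1] := ltP 1 eps.
  apply: (@le_trans _ _ (1 - r `^ c)^-1); last first.
    rewrite ler_peMl ?invr_ge0 ?subr_ge0 ?(ltW q1) //.
    by rewrite powR_ge1 ?(ltW c0) ?(ltW e1).
  apply: le_trans (geometric_sum_le N.+1 _); last by rewrite (ltW q0).
  rewrite big_mkcond; apply: ler_sum => l _.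
  by case: ifP => _; rewrite ?powR_exp ?exprn_ge0 ?(ltW r0) ?(ltW q0).
rewrite big_mkcond big_ord_recl /= expr0 ltNge e1 /= add0r -big_mkcond /=.
have -> : \sum_(i < N | r ^+ bump 0 i < eps) (r ^+ bump 0 i) `^ c
        = r `^ c * \sum_(l < N | r ^+ l < eps / r) (r ^+ l) `^ c.
  rewrite mulr_sumr; apply: eq_big => i; rewrite /bump /= add1n exprS.
    by rewrite ltr_pdivlMr // mulrC.
  by rewrite powRM ?exprn_ge0 ?(ltW r0).
apply: le_trans (ler_wpM2l (ltW q0) (IH _ (divr_gt0 e0 r0))) _.
rewrite powRM ?invr_ge0 ?(ltW r0) ?(ltW e0) //.
rewrite -(powR_inv1 (ltW r0)) -powRrM mulN1r powRN.
rewrite le_eqVlt; apply/orP; left; apply/eqP; field.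
by rewrite subr_eq0 gt_eqF //= gt_eqF.
Qed.

Lemma geometric_head_le r c eps N : 0 < r < 1 -> 0 < c -> 0 < eps ->
  \sum_(l < N | eps <= r ^+ l) (eps / r ^+ l) `^ c <= (1 - r `^ c)^-1.
Proof.
move=> r01 c0; have /andP[q0 q1] := powR_itv01 r01 c0.
have /andP[r0 r1] := r01 => e0.
(* The induction needs the sharp numerator: adding the level-0 term [eps ^ c] to the bound at
   [eps / r] gives exactly the bound at [eps]. The maximum with 0 covers [eps > 1], where the sum is
   empty. *)
suff H : \sum_(l < N | eps <= r ^+ l) (eps / r ^+ l) `^ c
    <= Num.max 0 (1 - r `^ c * eps `^ c) / (1 - r `^ c).
  apply: le_trans H _; rewrite ler_piMl ?invr_ge0 ?subr_ge0 ?(ltW q1) //.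
  rewrite ge_max ler01 /= lerBlDr lerDl.
  by rewrite mulr_ge0 ?powR_ge0.
rewrite ler_pdivlMr ?subr_gt0 //.
elim: N eps e0 => [|N IH] eps e0.
  by rewrite big_ord0 mul0r le_max lexx.
rewrite big_mkcond big_ord_recl /= expr0 divr1 -big_mkcond /=.
have -> : \sum_(i < N | eps <= r ^+ bump 0 i) (eps / r ^+ bump 0 i) `^ c
        = \sum_(l < N | eps / r <= r ^+ l) (eps / r / r ^+ l) `^ c.
  apply: eq_big => i; rewrite /bump /= add1n exprS.
    by rewrite ler_pdivrMr // mulrC.
  by rewrite invfM mulrA.
have := IH _ (divr_gt0 e0 r0).
have -> : r `^ c * (eps / r) `^ c = eps `^ c.
  by rewrite -powRM ?divr_ge0 ?(ltW r0) ?(ltW e0) // mulrCA divff ?mulr1 // gt_eqF.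
set S := \sum_(_ < _ | _) _; set x := eps `^ c => HS.
rewrite le_max; apply/orP; case: ifPn => [e1|].
  right; have x1 : x <= 1.
    by rewrite powR_le1 ?(ltW c0) ?(ltW e0) ?e1.
  have {}HS : S * (1 - r `^ c) <= 1 - x by move: HS; rewrite le_max; lra.
  by rewrite mulrDl; lra.
rewrite -ltNge => e1; left.
have x1 : 1 <= x.
  by rewrite powR_ge1 ?(ltW c0) ?(ltW e1).
by move: HS; rewrite le_max add0r; lra.
Qed.

(** Passing from [eps] to [eps / r] removes one level and lowers [ln eps^-1] by [- ln r >= 1 - r],
    hence lowers the bound by at least 1. *)
Lemma count_levels_le r eps N : 0 < r < 1 -> 0 < eps < 1 ->
  \sum_(l < N | eps <= r ^+ l) (1 : R) <= 1 + ln eps^-1 / (1 - r).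
Proof.
move=> /andP[r0 r1] /andP[e0 e1].
have d0 : 0 < 1 - r by lra.
have l0 : 0 <= ln eps^-1 by rewrite ln_ge0 // invf_ge1 // ltW.
suff H : \sum_(l < N | eps <= r ^+ l) (1 : R) <= Num.max 0 (1 + ln eps^-1 / (1 - r)).
  apply: le_trans H _; rewrite ge_max lexx andbT.
  by rewrite addr_ge0 // divr_ge0 // ltW.
elim: N eps e0 {e1 l0} => [|N IH] eps e0; first by rewrite big_ord0 le_max lexx.
rewrite big_mkcond big_ord_recl /= expr0 -big_mkcond /=.
have -> : \sum_(i < N | eps <= r ^+ bump 0 i) (1 : R)
        = \sum_(l < N | eps / r <= r ^+ l) 1.
  apply: eq_bigl => i; rewrite /bump /= add1n exprS.
  by rewrite ler_pdivrMr // mulrC.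
have [e1|e1] := leP eps 1; last first.
  rewrite add0r big_pred0 ?le_max ?lexx // => i; apply/negbTE; rewrite -ltNge.
  rewrite ltr_pdivlMr //; apply: le_lt_trans e1; rewrite -exprSr.
  by rewrite exprn_ile1 ?(ltW r0) ?(ltW r1).
have := IH _ (divr_gt0 e0 r0); set S := \sum_(_ < _ | _) _.
have -> : ln (eps / r)^-1 = ln eps^-1 + ln r.
  by rewrite invfM invrK lnM ?posrE ?invr_gt0.
have lr : ln r <= - (1 - r).
  have -> : ln r = ln (1 + (r - 1)) by congr ln; lra.
  by apply: le_trans (le_ln1Dx _) _; lra.
have l0 : 0 <= ln eps^-1 by rewrite ln_ge0 // invf_ge1.
have t0 : 0 <= ln eps^-1 / (1 - r) by rewrite divr_ge0 // ltW.
have : ln r / (1 - r) <= -1 by rewrite ler_pdivrMr // mulN1r.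
rewrite mulrDl !le_max.
by move=> ? /orP[?|?]; apply/orP; right; lra.
Qed.

End level_sums.

(** * Level sums against [Delta], and Gaussian sums by telescoping *)

Section discrete_scales.
Context {R : realType}.
Implicit Types alpha p r eps b x : R.

Lemma Delta_ge0 alpha p eps : 0 < alpha -> 0 < eps < 1 -> 0 <= Delta alpha p eps.
Proof.
move=> a0 /andP[e0 e1]; rewrite /Delta.
case: ifP => _; first by rewrite divr_ge0 ?powR_ge0.
case: ifP => _; first by rewrite mulr_ge0 ?powR_ge0 // ltW.
by rewrite divr_ge0 ?(ltW e0) // le_min powR_ge0 ler01.
Qed.

Lemma powR_powRV (p x : R) : 0 < p -> 0 <= x -> (x `^ p^-1) `^ p = x.
Proof. by move=> p0 x0; rewrite -powRrM mulVf ?gt_eqF // powRr1. Qed.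

Lemma powR_inv x p : 0 <= x -> x^-1 `^ p = (x `^ p)^-1.
Proof. by move=> x0; rewrite -(powR_inv1 x0) -powRrM mulN1r powRN. Qed.

Lemma min_powR1 x p : 0 <= p -> 0 <= x -> Num.min (x `^ p) 1 = (Num.min x 1) `^ p.
Proof.
move=> p0 x0; have [x1|x1] := leP x 1.
  by apply/min_idPl; rewrite powR_le1 ?x0.
by rewrite powR1; apply/min_idPr; rewrite powR_ge1 // ltW.
Qed.

(** The minimum is 1 in the tail [r ^+ l < eps] and [eps / r ^+ l] in the head. The three cases of
    [Delta] reflect whether the head terms grow, stay constant or decay with [l]. *)
Lemma level_sum_powR_le alpha p r eps N :
  0 < alpha -> 1 <= p -> 0 < r < 1 -> 0 < eps < 1 ->
  \sum_(l < N) ((r ^+ l) `^ alpha * Num.min 1 (eps / r ^+ l)) `^ p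
    <= 2 / (1 - r) * Delta alpha p eps `^ p.
Proof.
move=> a0 p1 r01 e01; have /andP[r0 r1] := r01; have /andP[e0 e1] := e01.
have p0 : 0 < p by lra.
have d0 : 0 < 1 - r by lra.
have rl0 l : 0 < r ^+ l by rewrite exprn_gt0.
have split N' (F G : nat -> R) :
    (forall l, 0 <= F l) -> (forall l, 0 <= G l) ->
    (forall l, r ^+ l < eps -> ((r ^+ l) `^ alpha * Num.min 1 (eps / r ^+ l)) `^ p <= F l) ->
    (forall l, eps <= r ^+ l -> ((r ^+ l) `^ alpha * Num.min 1 (eps / r ^+ l)) `^ p <= G l) ->
    \sum_(l < N') ((r ^+ l) `^ alpha * Num.min 1 (eps / r ^+ l)) `^ p
    <= \sum_(l < N' | r ^+ l < eps) F l + \sum_(l < N' | eps <= r ^+ l) G l.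
  move=> F0 G0 HF HG; rewrite (big_mkcond (fun l : 'I_N' => r ^+ l < eps)).
  rewrite (big_mkcond (fun l : 'I_N' => eps <= r ^+ l)) -big_split /=.
  apply: ler_sum => l _; have [h|h] := ltP (r ^+ l) eps.
    by rewrite addr0 HF.
  by rewrite add0r HG.
have tail l : r ^+ l < eps ->
    ((r ^+ l) `^ alpha * Num.min 1 (eps / r ^+ l)) `^ p <= (r ^+ l) `^ (alpha * p).
  move=> h; rewrite powRrM ge0_ler_powR ?nnegrE ?powR_ge0 ?(ltW p0) //.
    by rewrite mulr_ge0 ?powR_ge0 // le_min ler01 divr_ge0 // ltW.
  by rewrite ler_piMr ?powR_ge0 // ge_min lexx.
have head l : eps <= r ^+ l ->
    ((r ^+ l) `^ alpha * Num.min 1 (eps / r ^+ l)) `^ p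
      <= ((r ^+ l) `^ alpha * (eps / r ^+ l)) `^ p.
  move=> h; have ? : 0 <= eps / r ^+ l by rewrite divr_ge0 // ltW.
  have ? : 0 <= Num.min 1 (eps / r ^+ l) by rewrite le_min ler01.
  rewrite ge0_ler_powR ?nnegrE ?(ltW p0) ?(mulr_ge0 (powR_ge0 _ _)) //.
  by rewrite ler_wpM2l ?powR_ge0 // ge_min lexx orbT.
(* For [alpha < 1], tail and head are geometric with exponents [alpha * p] and [(1 - alpha) * p]. As
   [p >= 1], they contribute [1 / alpha] and [1 / (1 - alpha)], whose sum is
   [1 / (alpha - alpha ^+ 2)]. *)
rewrite /Delta; have [alt1|] := ltP alpha 1.
  rewrite powRM ?powR_ge0 ?invr_ge0 ?powR_ge0 // powR_inv ?powR_ge0 //.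
  have b0 : 0 < alpha - alpha ^+ 2 by nra.
  rewrite powR_powRV ?(ltW b0) //.
  have ga : (1 - r `^ (alpha * p))^-1 <= (alpha * (1 - r))^-1.
    rewrite lef_pV2 ?posrE ?mulr_gt0 //; last first.
      by rewrite subr_gt0; case/andP: (powR_itv01 r01 (mulr_gt0 a0 p0)).
    have := one_sub_powR_ge r01 (mulr_gt0 a0 p0); apply: le_trans.
    by rewrite ler_wpM2r ?(ltW d0) // le_min ler_peMr ?(ltW alt1) ?(ltW a0).
  have a10 : 0 < 1 - alpha by lra.
  have gb : (1 - r `^ ((1 - alpha) * p))^-1 <= ((1 - alpha) * (1 - r))^-1.
    rewrite lef_pV2 ?posrE ?mulr_gt0 //; last first.
      by rewrite subr_gt0; case/andP: (powR_itv01 r01 (mulr_gt0 a10 p0)).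
    have := one_sub_powR_ge r01 (mulr_gt0 a10 p0); apply: le_trans.
    rewrite ler_wpM2r ?(ltW d0) // le_min ler_peMr ?(ltW a10) // andbT.
    lra.
  apply: (le_trans (split _ (fun l => (r ^+ l) `^ (alpha * p))
    (fun l => eps `^ (alpha * p) * (eps / r ^+ l) `^ ((1 - alpha) * p)) _ _ tail _)).
  - by move=> l; rewrite powR_ge0.
  - by move=> l; rewrite mulr_ge0 ?powR_ge0.
  - move=> l h; apply: le_trans (head l h) _.
    rewrite !(powRrM _ _ p) -powRM ?powR_ge0 //.
    rewrite le_eqVlt; apply/orP; left; apply/eqP; congr powR.
    have er0 : 0 < eps / r ^+ l by rewrite divr_gt0.
    have {1}-> : eps / r ^+ l = (eps / r ^+ l) `^ alpha * (eps / r ^+ l) `^ (1 - alpha).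
      by rewrite -powRD ?(gt_eqF er0) ?implybT // addrC subrK powRr1 // ltW.
    rewrite mulrA -powRM ?(ltW er0) ?(ltW (rl0 l)) //.
    by rewrite mulrCA divff ?mulr1 // gt_eqF.
  rewrite -mulr_sumr.
  apply: (@le_trans _ _ (eps `^ (alpha * p) * ((alpha * (1 - r))^-1 + ((1 - alpha) * (1 - r))^-1))).
    rewrite mulrDr; apply: lerD.
      apply: le_trans (geometric_tail_le _ r01 (mulr_gt0 a0 p0) e0) _.
      by rewrite ler_wpM2l ?powR_ge0.
    rewrite ler_wpM2l ?powR_ge0 //.
    by apply: le_trans (geometric_head_le _ r01 (mulr_gt0 a10 p0) e0) gb.
  rewrite -powRrM.
  have -> : (alpha * (1 - r))^-1 + ((1 - alpha) * (1 - r))^-1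
      = (1 - r)^-1 / (alpha - alpha ^+ 2).
    by field; rewrite !gt_eqF //; nra.
  have : 0 <= eps `^ (alpha * p) * ((1 - r)^-1 / (alpha - alpha ^+ 2)).
    by rewrite mulr_ge0 ?powR_ge0 // mulr_ge0 // invr_ge0 ltW.
  lra.
have epsl0 l : 0 <= eps / r ^+ l by rewrite divr_ge0 // ltW.
have I0 : 0 < (1 - r)^-1 by rewrite invr_gt0.
rewrite le_eqVlt => /orP[/eqP a1|a1].
  (* For [alpha = 1] each head term is at most [eps ^ p], so the head reduces to counting levels;
     this is the source of the logarithm. *)
  subst alpha; rewrite eqxx powRM ?powR_ge0 ?(ltW e0) //.
  have l0 : 0 <= ln eps^-1 by rewrite ln_ge0 // invf_ge1 // ltW.
  have l1 : 0 <= ln eps^-1 + 1 by lra.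
  rewrite powR_powRV //.
  apply: (le_trans (split _ (fun l => (r ^+ l) `^ p) (fun l => eps `^ p) _ _ _ _)).
  - by move=> l; rewrite powR_ge0.
  - by move=> l; rewrite powR_ge0.
  - move=> l h; rewrite powRr1 ?(ltW (rl0 l)) //.
    rewrite ge0_ler_powR ?nnegrE ?(ltW p0) ?(ltW (rl0 l)) //.
      by rewrite mulr_ge0 ?(ltW (rl0 l)) // le_min ler01 epsl0.
    by rewrite ler_piMr ?(ltW (rl0 l)) // ge_min lexx.
  - move=> l h; rewrite powRr1 ?(ltW (rl0 l)) //.
    rewrite ge0_ler_powR ?nnegrE ?(ltW p0) ?(ltW e0) //.
      by rewrite mulr_ge0 ?(ltW (rl0 l)) // le_min ler01 epsl0.
    rewrite mulrC -ler_pdivlMr // ge_min lexx orbT //.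
  have H1 : \sum_(l < N | r ^+ l < eps) (r ^+ l) `^ p <= eps `^ p * (1 - r)^-1.
    apply: le_trans (geometric_tail_le _ r01 p0 e0) _.
    rewrite ler_wpM2l ?powR_ge0 // lef_pV2 ?posrE //.
      by rewrite lerD2l lerN2 ge1r_powR ?r0 ?(ltW r1).
    by rewrite subr_gt0; case/andP: (powR_itv01 r01 p0).
  have H2 : \sum_(l < N | eps <= r ^+ l) eps `^ p
      <= eps `^ p * (1 + ln eps^-1 / (1 - r)).
    rewrite -[X in \sum_(l < N | _) X]mulr1 -mulr_sumr ler_wpM2l ?powR_ge0 //.
    exact: count_levels_le.
  apply: le_trans (lerD H1 H2) _.
  rewrite -mulrDr mulrCA ler_wpM2l ?powR_ge0 //.
  have I1 : 1 <= (1 - r)^-1 by rewrite invf_ge1 //; lra.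
  have : 0 <= ln eps^-1 / (1 - r) by rewrite mulr_ge0 // ltW.
  nra.
(* For [alpha > 1] no splitting is made: bounding the minimum by [eps / r ^+ l] at every level
   leaves a geometric series of ratio [r ^ ((alpha - 1) * p)]. *)
rewrite (gt_eqF a1).
have c0 : 0 < alpha - 1 by lra.
have cp0 : 0 < (alpha - 1) * p by rewrite mulr_gt0.
rewrite min_powR1 ?invr_ge0 ?(ltW p0) ?(ltW c0) //.
set m := Num.min (alpha - 1) 1.
have m0 : 0 < m by rewrite lt_min c0 ltr01.
rewrite powRM ?(ltW e0) ?invr_ge0 ?powR_ge0 // powR_inv ?powR_ge0 //.
rewrite powR_powRV ?(ltW m0) //.
apply: (@le_trans _ _ (eps `^ p * \sum_(l < N) (r `^ ((alpha - 1) * p)) ^+ l)).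
  rewrite mulr_sumr; apply: ler_sum => l _.
  rewrite -powR_exp ?(ltW r0) // powRrM -powRM ?powR_ge0 ?(ltW e0) //.
  rewrite ge0_ler_powR ?nnegrE ?(ltW p0) //.
  - by rewrite mulr_ge0 ?powR_ge0 // le_min ler01 epsl0.
  - by rewrite mulr_ge0 ?powR_ge0 // ltW.
  apply: (@le_trans _ _ ((r ^+ l) `^ alpha * (eps / r ^+ l))).
    by rewrite ler_wpM2l ?powR_ge0 // ge_min lexx orbT.
  rewrite powRB ?(gt_eqF (rl0 l)) ?implybT // powRr1 ?(ltW (rl0 l)) //.
  by rewrite mulrCA.
have /andP[q0 q1] := powR_itv01 r01 cp0.
rewrite [leRHS]mulrCA ler_wpM2l ?powR_ge0 //.
apply: le_trans (geometric_sum_le N _) _; first by rewrite (ltW q0).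
apply: (@le_trans _ _ (m * (1 - r))^-1).
  rewrite lef_pV2 ?posrE ?mulr_gt0 ?subr_gt0 //.
  apply: le_trans (one_sub_powR_ge r01 cp0).
  rewrite ler_wpM2r ?(ltW d0) // le_min !ge_min lexx orbT /=.
  by rewrite ler_peMr ?(ltW c0).
rewrite invfM mulrC.
have : 0 <= (1 - r)^-1 / m by rewrite divr_ge0 ?ltW.
lra.
Qed.

Lemma level_sum_le alpha p r eps N :
  0 < alpha -> 1 <= p -> 0 < r < 1 -> 0 < eps < 1 ->
  (\sum_(l < N) ((r ^+ l) `^ alpha * Num.min 1 (eps / r ^+ l)) `^ p) `^ p^-1
    <= 2 / (1 - r) * Delta alpha p eps.
Proof.
move=> a0 p1 r01 e01; have p0 : 0 < p by lra.
have D0 := Delta_ge0 p a0 e01.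
(* A constant at least 1 dominates its own [p]-th root, so the root costs nothing. *)
have k1 : 1 <= 2 / (1 - r) by case/andP: r01 => ? ?; rewrite ler_pdivlMr; lra.
have k0 : 0 <= 2 / (1 - r) by lra.
apply: (@le_trans _ _ ((2 / (1 - r) * Delta alpha p eps `^ p) `^ p^-1)).
  rewrite ge0_ler_powR ?nnegrE ?invr_ge0 ?(ltW p0) ?(mulr_ge0 k0 (powR_ge0 _ _)) //.
    by apply: sumr_ge0 => l _; rewrite powR_ge0.
  exact: level_sum_powR_le.
rewrite powRM ?powR_ge0 // -powRrM divff ?gt_eqF // powRr1 //.
by rewrite ler_wpM2r // ler1_powR // invf_le1.
Qed.

(** The right side equals [4 / ((1 + x) * (1 + x + b))], and [(1 + x) * (1 + x + b) <= 2 * (1 + x)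
    ^+ 2 <= 4 * (1 + x ^+ 2)] because [b <= 1]. *)
Lemma expR_sqr_le b x : 0 < b <= 1 -> 0 <= x ->
  expR (- x ^+ 2) <= 4 / b * ((x + b) / (1 + (x + b)) - x / (1 + x)).
Proof.
move=> /andP[b0 b1] x0.
have -> : 4 / b * ((x + b) / (1 + (x + b)) - x / (1 + x))
    = 4 / ((1 + x) * (1 + (x + b))).
  by field; rewrite !gt_eqF //; lra.
rewrite expRN ler_pdivlMr; last by rewrite mulr_gt0; lra.
rewrite mulrC ler_pdivrMr ?expR_gt0 //.
have := expR_ge1Dx (x ^+ 2); have := sqr_ge0 (x - 1).
have : 0 <= (1 + x) * (1 + x - b) by rewrite mulr_ge0; lra.
lra.
Qed.

(** Plays the role of a primitive of the Gaussian: a bounded increasing function whose increments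
    dominate the Gaussian values. *)
Definition softsign x : R := x / (1 + `|x|).

Lemma softsign_bound x : - 1 <= softsign x <= 1.
Proof.
have h : 0 < 1 + `|x| by have := normr_ge0 x; lra.
rewrite /softsign ler_pdivlMr // ler_pdivrMr //.
by have := ler_norm x; have := ler_norm (- x); rewrite normrN; lra.
Qed.

(** Negative [k] follows by reflection: [softsign] is odd, and with [y = - b * (k + 1)] the Gaussian
    at [y + b] is at most that at [y]. *)
Lemma expR_sqr_le_softsign b (k : int) : 0 < b <= 1 ->
  expR (- (b * k%:~R) ^+ 2)
    <= 4 / b * (softsign (b * (k + 1)%:~R) - softsign (b * k%:~R)).
Proof.
move=> b01; have /andP[b0 b1] := b01; rewrite /softsign.
have [k0|k0] := leP 0 k.
  have x0 : 0 <= b * k%:~R by rewrite mulr_ge0 ?(ltW b0) // ler0z.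
  have -> : b * (k + 1)%:~R = b * k%:~R + b by rewrite intrD mulrDr mulr1.
  rewrite !ger0_norm //; last by rewrite addr_ge0 // ltW.
  exact: expR_sqr_le.
have {}k0 : k + 1 <= 0 by rewrite addrC lez1D.
set y := - (b * (k + 1)%:~R).
have y0 : 0 <= y by rewrite oppr_ge0 pmulr_rle0 // lerz0.
have yE : b * k%:~R = - (y + b) by rewrite /y intrD mulrDr mulr1; lra.
have -> : b * (k + 1)%:~R = - y by rewrite opprK.
have yb0 : 0 <= y + b by rewrite addr_ge0 // ltW.
clearbody y; rewrite yE !normrN (ger0_norm y0) (ger0_norm yb0).
apply: le_trans (_ : expR (- y ^+ 2) <= _).
  by rewrite ler_expR sqrrN lerN2 -subr_ge0; have := mulr_ge0 y0 (ltW b0); nra.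
apply: le_trans (expR_sqr_le b01 y0) _.
by rewrite !mulNr opprK addrC.
Qed.

(** The increments telescope, and the total variation of [softsign] is at most 2, whatever [n] and
    the shift [h]. *)
Lemma gauss_sum_le b n (h : nat) : 0 < b <= 1 ->
  \sum_(m < n) expR (- (b * (m%:Z - h%:Z)%:~R) ^+ 2) <= 8 / b.
Proof.
move=> b01; have /andP[b0 b1] := b01.
pose F (m : nat) := softsign (b * (m%:Z - h%:Z)%:~R).
apply: (@le_trans _ _ (4 / b * \sum_(m < n) (F m.+1 - F m))).
  rewrite mulr_sumr; apply: ler_sum => m _.
  apply: le_trans (expR_sqr_le_softsign _ b01) _.
  rewrite /F (_ : m.+1%:Z - h%:Z = m%:Z - h%:Z + 1) //.
  by rewrite -[m.+1]addn1 PoszD addrAC.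
rewrite -(big_mkord xpredT (fun m => F m.+1 - F m)) telescope_sumr //.
have -> : 8 / b = 4 / b * 2 by lra.
rewrite ler_wpM2l ?divr_ge0 ?(ltW b0) // /F.
have /andP[_ h1] := softsign_bound (b * (n%:Z - h%:Z)%:~R).
have /andP[h2 _] := softsign_bound (b * (0%:Z - h%:Z)%:~R).
lra.
Qed.

End discrete_scales.

(** * Independence *)

Section independence.
Local Open Scope ereal_scope.
Context d (T : measurableType d) (R : realType) (P : probability T R).

(** Both sides are finite measures in [A]; agreeing on a pi-system that contains the whole space,
    they agree on the sigma-algebra it generates. *)
Lemma probability_setI_sigma (G : set (set T)) (D : set T) :
  G `<=` measurable -> setI_closed G -> G setT -> measurable D ->
  (forall A, G A -> P (A `&` D) = P A * P D) ->
  forall A, <<s G >> A -> P (A `&` D) = P A * P D.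
Proof.
move=> mG GI GT mD indep A sGA.
have PD0 : (0 <= fine (P D))%R by rewrite fine_ge0.
pose m2 := mscale (NngNum PD0) P.
have m2E B : m2 B = P B * P D.
  by rewrite /m2 /mscale /= fineK ?fin_num_measure // muleC.
rewrite -m2E; pose m1 := mrestr P mD.
rewrite -[LHS]/(m1 A).
apply: (@g_sigma_algebra_measure_unique _ _ _ G mG (fun=> setT)) => //.
- by rewrite bigcup_const.
- by move=> B GB; have := indep B GB; rewrite -m2E.
- move=> _; suff : P (setT `&` D) < +oo by [].
  by rewrite setTI ltey_eq fin_num_measure.
Qed.

(** The joint law is the product of the two laws since they agree on rectangles; Tonelli's theorem
    then separates the integrals. *)
Lemma ge0_integral_decoupled d1 d2 (T1 : measurableType d1)
    (T2 : measurableType d2) (X : {mfun T >-> T1}) (Z : {mfun T >-> T2})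
    (F : T1 * T2 -> \bar R) :
  (forall A B, measurable A -> measurable B ->
    P (X @^-1` A `&` Z @^-1` B) = P (X @^-1` A) * P (Z @^-1` B)) ->
  measurable_fun setT F -> (forall x, 0 <= F x) ->
  \int[P]_w F (X w, Z w) = \int[P]_w \int[P]_w' F (X w, Z w').
Proof.
move=> indep mF F0.
pose phi w := (X w, Z w).
have mphi : measurable_fun setT phi by exact: measurable_fun_pair.
transitivity (\int[pushforward P phi]_x F x).
  by rewrite ge0_integral_pushforward.
transitivity (\int[distribution P X \x distribution P Z]_x F x).
  apply: eq_measure_integral => A mA _; apply/esym.
  apply: (@product_measure_unique _ _ _ _ _ (distribution P X) (distribution P Z)) => //.
rewrite fubini_tonelli1 // ge0_integral_distribution //.
- apply: eq_integral => w _; rewrite /= /fubini_F ge0_integral_distribution //.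
  exact: measurableT_comp.
- exact: measurable_fun_fubini_tonelli_F.
- by move=> y; apply: integral_ge0.
Qed.

Lemma measurable_fun_decoupled d1 d2 (T1 : measurableType d1)
    (T2 : measurableType d2) (X : {mfun T >-> T1}) (Z : {mfun T >-> T2})
    (F : T1 * T2 -> \bar R) :
  measurable_fun setT F -> (forall x, 0 <= F x) ->
  measurable_fun setT (fun w => \int[P]_w' F (X w, Z w')).
Proof.
move=> mF F0.
rewrite (_ : (fun w => _) = fubini_F (distribution P Z) F \o X).
  apply: measurableT_comp => //.
  exact: measurable_fun_fubini_tonelli_F.
apply/funext => w; rewrite /= /fubini_F ge0_integral_distribution //.
exact: measurableT_comp.
Qed.

End independence.

(** * Sub-Gaussian variables *)

Section integral_bounds.
Context d (T : measurableType d) (R : realType) (P : probability T R).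

Lemma integral_cst_probability (r : R) : (\int[P]_w r%:E)%E = r%:E.
Proof. by have := expectation_cst P r; rewrite unlock. Qed.

Lemma ge0_integral_le_affine (I : finType) (f : T -> R) (g : I -> T -> R)
    (a : R) (b m : I -> R) :
  measurable_fun setT f -> (forall i, measurable_fun setT (g i)) ->
  (forall w, 0 <= f w) -> (forall i w, 0 <= g i w) ->
  0 <= a -> (forall i, 0 <= b i) ->
  (forall w, f w <= a + \sum_i b i * g i w) ->
  (forall i, (\int[P]_w (g i w)%:E <= (m i)%:E)%E) ->
  (\int[P]_w (f w)%:E <= (a + \sum_i b i * m i)%:E)%E.
Proof.
move=> mf mg f0 g0 a0 b0 fg gm.
have mbg i : measurable_fun setT (fun w => (b i * g i w)%:E).
  by apply/measurable_EFinP; exact: measurable_funM.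
apply: (@le_trans _ _ (\int[P]_w (a%:E + \sum_i (b i * g i w)%:E))%E).
  apply: ge0_le_integral => //.
  - by move=> w _; rewrite lee_fin.
  - exact/measurable_EFinP.
  - by apply: emeasurable_funD => //; exact: emeasurable_sum.
  - by move=> w _; rewrite sumEFin -EFinD lee_fin.
rewrite ge0_integralD //; last 2 first.
- by move=> w _; apply: sume_ge0 => i _; rewrite lee_fin mulr_ge0.
- exact: emeasurable_sum.
rewrite integral_cst_probability ge0_integral_sum //; last first.
  by move=> i w _; rewrite lee_fin mulr_ge0.
rewrite EFinD leeD2l // -sumEFin; apply: lee_sum => i _.
under eq_integral do rewrite EFinM.
rewrite ge0_integralZl_EFin //.
- by rewrite EFinM lee_wpmul2l // lee_fin.
- by move=> w _; rewrite lee_fin.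
- exact/measurable_EFinP.
Qed.

Lemma measurable_expR_comp d' (T' : measurableType d') (f : T' -> R) :
  measurable_fun setT f -> measurable_fun setT (fun w => expR (f w)).
Proof. by move=> mf; apply: measurableT_comp mf; exact: measurable_expR. Qed.

Lemma measurable_scale d' (T' : measurableType d') (f : T' -> R) (a : R) :
  measurable_fun setT f -> measurable_fun setT (fun w => a * f w).
Proof. by move=> mf; exact: measurable_funM. Qed.

Lemma ge0_integral_le_scale (f g : T -> R) (b m : R) :
  measurable_fun setT f -> measurable_fun setT g ->
  (forall w, 0 <= f w) -> (forall w, 0 <= g w) -> 0 <= b ->
  (forall w, f w <= b * g w) -> (\int[P]_w (g w)%:E <= m%:E)%E ->
  (\int[P]_w (f w)%:E <= (b * m)%:E)%E.
Proof.
move=> mf mg f0 g0 b0 fg gm.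
have := @ge0_integral_le_affine unit f (fun=> g) 0 (fun=> b) (fun=> m) mf.
rewrite big_const card_unit /= !add0r addr0; apply=> // w.
by rewrite big_const card_unit /= add0r addr0.
Qed.

End integral_bounds.

Section subgaussian_variable.
Context d (T : measurableType d) (R : realType) (P : probability T R).
Variables (Z : {RV P >-> R}) (t : R).
Hypothesis t0 : 0 < t.
Hypothesis EZ2 : (\int[P]_w (expR (Z w ^+ 2 / t ^+ 2))%:E <= 2%:E)%E.

Let mZ : measurable_fun setT Z. Proof. by []. Qed.
Let mZ2 c : measurable_fun setT (fun w => expR (c * Z w ^+ 2)).
Proof. by apply/measurable_expR_comp/measurable_scale/measurable_funX. Qed.
Let mZ2t : measurable_fun setT (fun w => expR (Z w ^+ 2 / t ^+ 2)).
Proof. by under eq_fun do rewrite mulrC; exact: mZ2. Qed.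
Let mZ1 a : measurable_fun setT (fun w => expR (a * Z w)).
Proof. by apply/measurable_expR_comp/measurable_scale. Qed.

(** With [a = c * t ^+ 2], the chord inequality bounds the moment by [1 - a + 2 * a = 1 + a], which
    is at most [expR a]. *)
Lemma expR_sqr_moment_le c : 0 <= c -> c * t ^+ 2 <= 1 ->
  (\int[P]_w (expR (c * Z w ^+ 2))%:E <= (expR (c * t ^+ 2))%:E)%E.
Proof.
move=> c0 ct; set a := c * t ^+ 2.
have a0 : 0 <= a by rewrite mulr_ge0 ?sqr_ge0.
have := @ge0_integral_le_affine _ _ _ P unit _ (fun=> fun w => expR (Z w ^+ 2 / t ^+ 2))
  (1 - a) (fun=> a) (fun=> 2) (mZ2 c).
rewrite big_const card_unit /= addr0 => /(_ _ _ _ _ _ _ _)/le_trans; apply => //.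
- by rewrite subr_ge0.
- move=> w; rewrite big_const card_unit /= addr0.
  have -> : c * Z w ^+ 2 = a * (Z w ^+ 2 / t ^+ 2).
    by rewrite /a; field; rewrite gt_eqF.
  by have := @expR_chord R a (Z w ^+ 2 / t ^+ 2); rewrite a0 ct => /(_ isT); lra.
- by rewrite lee_fin; have := expR_ge1Dx a; lra.
Qed.

Hypothesis EZ : ('E_P[Z] = 0)%E.

Lemma expR_linear_moment_le a :
  (\int[P]_w (expR (a * Z w))%:E <= (expR (3 * a ^+ 2 * t ^+ 2))%:E)%E.
Proof.
have at0 : 0 <= a ^+ 2 * t ^+ 2 by rewrite mulr_ge0 ?sqr_ge0.
(* For large [a], [a * Z <= a ^+ 2 * t ^+ 2 / 4 + Z ^+ 2 / t ^+ 2], and the factor 2 from the moment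
   is below [expR (2 * a ^+ 2 * t ^+ 2)]. For small [a] the zero mean is used, through
   [expR_le_add_expR_sqr]. *)
have [at1|at1] := leP (2 * a ^+ 2 * t ^+ 2) 1; last first.
  apply: le_trans (ge0_integral_le_scale (b := expR (a ^+ 2 * t ^+ 2 / 4)) _ mZ2t _ _ _ _ EZ2) _ => //.
  - move=> w; rewrite -expRD ler_expR.
    have : 0 <= (a * t / 2 - Z w / t) ^+ 2 by rewrite sqr_ge0.
    rewrite sqrrB !exprMn exprVn.
    have -> : (a * t / 2) * (Z w / t) = a * Z w / 2 by field; rewrite gt_eqF.
    lra.
  - rewrite lee_fin.
    apply: (@le_trans _ _ (expR (a ^+ 2 * t ^+ 2 / 4) * expR (2 * a ^+ 2 * t ^+ 2))).
      rewrite ler_wpM2l ?expR_ge0 //.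
      by have := expR_ge1Dx (2 * a ^+ 2 * t ^+ 2); lra.
    by rewrite -expRD ler_expR; lra.
have E2 := expR_sqr_moment_le (mulr_ge0 (ler0n R 2) (sqr_ge0 a)) at1.
have intS : P.-integrable setT (fun w => (expR (2 * a ^+ 2 * Z w ^+ 2))%:E).
  apply/integrableP; split; first exact/measurable_EFinP.
  under eq_integral do rewrite gee0_abs ?lee_fin ?expR_ge0 //.
  by apply: le_lt_trans E2 _; rewrite ltry.
(* Integrability of [Z] is recovered below from that of [a * Z] by dividing by [a]. *)
have [a0|an0] := eqVneq a 0.
  rewrite (_ : (fun w => _) = fun=> 1%:E); last first.
    by apply/funext => w; rewrite a0 mul0r expR0.
  rewrite integral_cst_probability lee_fin.
  by rewrite -[leLHS]expR0 ler_expR; lra.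
have intZ : P.-integrable setT (fun w => (a * Z w)%:E).
  apply: le_integrable intS => //.
  - by apply/measurable_EFinP; exact: measurable_scale.
  - move=> w _ /=; rewrite lee_fin (ger0_norm (expR_ge0 _)).
    have := expR_ge1Dx (2 * a ^+ 2 * Z w ^+ 2).
    have : 0 <= (1 - `|a * Z w|) ^+ 2 by rewrite sqr_ge0.
    rewrite sqrrB expr1n real_normK ?num_real // exprMn.
    have : 0 <= a ^+ 2 * Z w ^+ 2 by rewrite mulr_ge0 ?sqr_ge0.
    lra.
have EaZ : (\int[P]_w (a * Z w)%:E = 0)%E.
  under eq_integral do rewrite EFinM.
  rewrite integralZl //.
    by move: EZ; rewrite expectation_def => ->; rewrite mule0.
  have := integrableZl measurableT a^-1 intZ.
  apply: eq_integrable => // w _ /=.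
  by rewrite -EFinM mulrA mulVf // mul1r.
apply: (@le_trans _ _ (\int[P]_w ((a * Z w)%:E + (expR (2 * a ^+ 2 * Z w ^+ 2))%:E))%E).
  apply: ge0_le_integral => //.
  - by apply/measurable_EFinP; exact: mZ1.
  - apply: emeasurable_funD; first by apply/measurable_EFinP; exact: measurable_scale.
    exact/measurable_EFinP.
  - move=> w _; rewrite -EFinD lee_fin.
    by have := expR_le_add_expR_sqr (a * Z w); rewrite exprMn mulrA.
rewrite integralD // EaZ add0e; apply: le_trans E2 _.
by rewrite lee_fin ler_expR; lra.
Qed.

(** The two exponents are decoupled by [x * y <= (x ^+ 2 + y ^+ 2) / 2], which doubles [a] and [c].
    The resulting mean of two numbers that are at least 1 is at most their product. *)
Lemma expR_quadratic_moment_le a c : 0 <= c -> 2 * c * t ^+ 2 <= 1 ->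
  (\int[P]_w (expR (a * Z w + c * Z w ^+ 2))%:E
    <= (expR (12 * a ^+ 2 * t ^+ 2 + 2 * c * t ^+ 2))%:E)%E.
Proof.
move=> c0 ct.
have c20 : 0 <= 2 * c by rewrite mulr_ge0.
pose g (b : bool) w := if b then expR (2 * a * Z w) else expR (2 * c * Z w ^+ 2).
pose m (b : bool) := if b then expR (3 * (2 * a) ^+ 2 * t ^+ 2) else expR (2 * c * t ^+ 2).
have mf : measurable_fun setT (fun w => expR (a * Z w + c * Z w ^+ 2)).
  apply: measurable_expR_comp; apply: measurable_funD; first exact: measurable_scale.
  by apply/measurable_scale/measurable_funX.
have := @ge0_integral_le_affine _ _ _ P bool _ g 0 (fun=> 2^-1) m mf.
rewrite big_bool /= add0r => /(_ _ _ _ _ _ _ _)/le_trans; apply => //.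
- by case; rewrite /g.
- by case=> w; rewrite /g.
- move=> w; rewrite big_bool /= add0r.
  have -> : 2 * a * Z w = a * Z w + a * Z w by ring.
  have -> : 2 * c * Z w ^+ 2 = c * Z w ^+ 2 + c * Z w ^+ 2 by ring.
  rewrite !expRD; have := sqr_ge0 (expR (a * Z w) - expR (c * Z w ^+ 2)).
  lra.
- by case; [exact: expR_linear_moment_le|exact: expR_sqr_moment_le].
rewrite lee_fin expRD.
have -> : 3 * (2 * a) ^+ 2 * t ^+ 2 = 12 * a ^+ 2 * t ^+ 2 by ring.
have : 1 <= expR (12 * a ^+ 2 * t ^+ 2).
  by rewrite -[leLHS]expR0 ler_expR -mulrA mulr_ge0 // mulr_ge0 ?sqr_ge0.
have : 1 <= expR (2 * c * t ^+ 2).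
  by rewrite -[leLHS]expR0 ler_expR mulr_ge0 ?sqr_ge0.
set x := expR (2 * c * _); set y := expR (12 * _ * _); nra.
Qed.

End subgaussian_variable.

(** * Norms of independent sums *)

Section mutual_independence.
Context d (T : measurableType d) (R : realType) (P : probability T R).
Context (I : finType) (Z : I -> {RV P >-> R}) (m : I).

(* A pi-system generating the sigma-algebra of the [Z i] with [i != m]. *)
Definition cylinders : set (set T) :=
  [set A | exists B : I -> set R,
    [/\ forall i, measurable (B i), B m = setT &
        A = \bigcap_(i in setT) (Z i @^-1` B i)]].

Lemma cylinders_measurable : cylinders `<=` measurable.
Proof.
move=> A [B [mB _ ->]]; apply: fin_bigcap_measurable => // i _.
rewrite -[X in measurable X]setTI; exact: measurable_funPT.
Qed.

Lemma cylinders_setI : setI_closed cylinders.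
Proof.
move=> A A' [B [mB Bm ->]] [B' [mB' Bm' ->]]; exists (fun i => B i `&` B' i).
split; first by move=> i; exact: measurableI.
  by rewrite Bm Bm' setTI.
by rewrite -bigcapI.
Qed.

Lemma cylinders_setT : cylinders setT.
Proof.
exists (fun=> setT); split => //.
by rewrite bigcapT // => i; rewrite preimage_setT.
Qed.

Lemma cylinders_preimage i (B : set R) :
  i != m -> measurable B -> cylinders (Z i @^-1` B).
Proof.
move=> im mB; exists (fun j => if j == i then B else setT); split.
- by move=> j; case: ifP.
- by rewrite eq_sym (negbTE im).
apply/seteqP; split=> [w Bw j _|w /(_ i Logic.I)] /=; last by rewrite eqxx.
by case: eqP => // ->.
Qed.

Hypothesis indep : mutually_independent Z.

(** Putting [B] in the free slot [m] turns the intersection into another one over all of [I], so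
    mutual independence factors both sides. *)
Lemma cylinders_independent (A : set T) (B : set R) :
  cylinders A -> measurable B ->
  P (A `&` Z m @^-1` B) = (P A * P (Z m @^-1` B))%E.
Proof.
move=> [C [mC Cm ->]] mB.
pose J : {set I} := finset.finset (fun=> true).
have setTE (F : I -> set T) : \bigcap_(i in setT) F i = \bigcap_(i in [set` J]) F i.
  by apply: eq_bigcapl; split => i //= _; rewrite finset.in_set.
pose C' i := if i == m then B else C i.
have -> : \bigcap_(i in setT) (Z i @^-1` C i) `&` Z m @^-1` B
    = \bigcap_(i in setT) (Z i @^-1` C' i).
  apply/seteqP; split => [w [h1 h2] i _|w h].
    by rewrite /C' /=; case: eqP => [->|_] //; exact: h1.
  split; last by have := h m Logic.I; rewrite /C' /= eqxx.
  move=> i _; have := h i Logic.I; rewrite /C' /=; case: eqP => // ->.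
  by rewrite Cm.
rewrite !setTE !indep //; last by move=> i _; rewrite /C'; case: ifP.
rewrite (bigD1 m) ?inE //= [in RHS](bigD1 m) ?inE //=.
rewrite /C' eqxx Cm preimage_setT probability_setT mul1e muleC; congr (_ * _)%E.
by apply: eq_bigr => i /andP[_ /negbTE ->].
Qed.

Lemma measurable_fun_cylinders i : i != m ->
  measurable_fun [set: g_sigma_algebraType cylinders] (Z i).
Proof.
move=> im _ B mB; rewrite setTI.
by apply: sub_sigma_algebra; exact: cylinders_preimage.
Qed.

(** Integrates out [Z m] with all other variables frozen; this is the inductive step for sums of
    independent vectors. *)
Lemma mutually_independent_integral_le
    (F : g_sigma_algebraType cylinders * R -> \bar R) (H : T -> \bar R) :
  measurable_fun setT F -> (forall x, (0 <= F x)%E) -> measurable_fun setT H ->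
  (forall w, \int[P]_w' F (w, Z m w') <= H w)%E ->
  (\int[P]_w F (w, Z m w) <= \int[P]_w H w)%E.
Proof.
move=> mF F0 mH FH.
have sGm : <<s cylinders >> `<=` d.-measurable.
  apply: smallest_sub; first exact: sigma_algebra_measurable.
  exact: cylinders_measurable.
(* The identity of [T], seen as a random element for the sigma-algebra of the other variables,
   stands for all of them at once. *)
pose idG : T -> g_sigma_algebraType cylinders := id.
have mid : measurable_fun setT idG by move=> _ B mB; rewrite setTI; exact: sGm.
pose idmf : {mfun T >-> g_sigma_algebraType cylinders} :=
  HB.pack idG (isMeasurableFun.Build _ _ _ _ _ mid).
have -> : (\int[P]_w F (w, Z m w) = \int[P]_w \int[P]_w' F (w, Z m w'))%E.
  apply: (@ge0_integral_decoupled _ _ _ P _ _ _ _ idmf (Z m) F) => // A B mA mB.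
  apply: (@probability_setI_sigma _ _ _ P cylinders) => //.
  - exact: cylinders_measurable.
  - exact: cylinders_setI.
  - exact: cylinders_setT.
  - by rewrite -[X in measurable X]setTI; exact: measurable_funPT.
  - by move=> A' cA'; exact: cylinders_independent.
apply: ge0_le_integral => //.
- by move=> w _; exact: integral_ge0.
- exact: (@measurable_fun_decoupled _ _ _ P _ _ _ _ idmf (Z m) F).
Qed.

End mutual_independence.

Lemma measurable_fun_comp_fst d1 d2 d3 (T1 : measurableType d1)
    (T2 : measurableType d2) (T3 : measurableType d3) (f : T1 -> T3) :
  measurable_fun setT f -> measurable_fun setT (fun x : T1 * T2 => f x.1).
Proof. by move=> mf; apply: measurableT_comp mf _; exact: measurable_fst. Qed.

Lemma measurable_sum_cylinders d (T : measurableType d) (R : realType)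
    (P : probability T R) (I : finType) (Z : I -> {RV P >-> R}) (m : I)
    (s : seq I) (c : I -> R) : m \notin s ->
  measurable_fun [set: g_sigma_algebraType (cylinders Z m)]
    (fun w => \sum_(i <- s) Z i w * c i).
Proof.
move=> ms; rewrite (_ : (fun w => _) =
    fun w => \sum_(i <- s) (if i == m then 0 else Z i w * c i)).
  apply: measurable_sum => i; have [_|im] := eqVneq i m.
    exact: measurable_cst.
  by apply: measurable_funM; [exact: measurable_fun_cylinders|exact: measurable_cst].
apply/funext => w; apply: eq_big_seq => i si.
by case: eqP => // im; rewrite -im si in ms.
Qed.

Lemma sumr_cauchy_schwarz (R : realFieldType) (K : finType) (a b : K -> R) :
  (\sum_k a k * b k) ^+ 2 <= (\sum_k a k ^+ 2) * (\sum_k b k ^+ 2).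
Proof.
set A := \sum_k a k ^+ 2; set B := \sum_k b k ^+ 2; set C := \sum_k a k * b k.
have B0 : 0 <= B by apply: sumr_ge0 => k _; rewrite sqr_ge0.
have [B00|Bn0] := eqVneq B 0.
  have b0 k : b k = 0.
    apply/eqP; rewrite -sqrf_eq0; move/eqP: B00.
    by rewrite psumr_eq0 => [/allP/(_ k)|i _]; rewrite ?sqr_ge0 // mem_index_enum => /(_ isT).
  by rewrite /C B00 mulr0 big1 ?expr0n // => k _; rewrite b0 mulr0.
have Bp : 0 < B by rewrite lt_neqAle eq_sym Bn0.
have : 0 <= \sum_k (B * a k - C * b k) ^+ 2.
  by apply: sumr_ge0 => k _; rewrite sqr_ge0.
have -> : \sum_k (B * a k - C * b k) ^+ 2 = B * (A * B - C ^+ 2).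
  transitivity (B ^+ 2 * A - 2 * B * C * C + C ^+ 2 * B); last by ring.
  have -> : B ^+ 2 * A = \sum_k B ^+ 2 * a k ^+ 2 by rewrite mulr_sumr.
  have -> : 2 * B * C * C = \sum_k 2 * B * C * (a k * b k) by rewrite -mulr_sumr.
  have -> : C ^+ 2 * B = \sum_k C ^+ 2 * b k ^+ 2 by rewrite -mulr_sumr.
  rewrite -sumrB -big_split /=.
  by apply: eq_bigr => k _; ring.
by rewrite pmulr_rge0 // subr_ge0.
Qed.

Section hilbert_subgaussian.
Context d (T : measurableType d) (R : realType) (P : probability T R).
Context (I K : finType) (Z : I -> {RV P >-> R}) (v : I -> K -> R) (t : I -> R).
Hypothesis indep : mutually_independent Z.
Hypothesis t0 : forall i, 0 < t i.
Hypothesis EZ : forall i, ('E_P[Z i] = 0)%E.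
Hypothesis EZ2 : forall i, (\int[P]_w (expR (Z i w ^+ 2 / t i ^+ 2))%:E <= 2%:E)%E.

(* 48 = 12 * 2 ^ 2: the 12 of [expR_quadratic_moment_le], used with
   [a = 2 * lam * \sum_k v i k * u k]. *)
Let beta i := 48 * (t i ^+ 2 * \sum_k v i k ^+ 2).

Let beta_ge0 i : 0 <= beta i.
Proof.
apply: mulr_ge0 => //; apply: mulr_ge0; first exact: sqr_ge0.
by apply: sumr_ge0 => k _; exact: sqr_ge0.
Qed.

(** Expanding the square gives a quadratic in [Z i] with coefficients [2 * lam * S] and [lam * V].
    By Cauchy-Schwarz [S ^+ 2 <= V * U], so the linear part costs at most
    [lam * (lam * beta i) * U]; then [1 + x] and [expR x] are both at most [1 / (1 - x)]. *)
Lemma expR_norm_sqr_step i lam (u : K -> R) : 0 <= lam -> lam * beta i < 1 ->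
  (\int[P]_w (expR (lam * \sum_k (Z i w * v i k + u k) ^+ 2))%:E
   <= ((1 - lam * beta i)^-1 * expR (lam / (1 - lam * beta i) * \sum_k u k ^+ 2))%:E)%E.
Proof.
move=> lam0 lb1.
set V := \sum_k v i k ^+ 2; set U := \sum_k u k ^+ 2; pose S := \sum_k v i k * u k.
have V0 : 0 <= V by apply: sumr_ge0 => k _; rewrite sqr_ge0.
have U0 : 0 <= U by apply: sumr_ge0 => k _; rewrite sqr_ge0.
have lV0 : 0 <= lam * V by rewrite mulr_ge0.
have lVt0 : 0 <= lam * V * t i ^+ 2 by rewrite mulr_ge0 ?sqr_ge0.
have bE : lam * beta i = 48 * (lam * V * t i ^+ 2) by rewrite /beta -/V; ring.
have expandE w : lam * \sum_k (Z i w * v i k + u k) ^+ 2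
    = lam * U + (2 * lam * S * Z i w + lam * V * Z i w ^+ 2).
  transitivity (lam * (U + (2 * Z i w * S + Z i w ^+ 2 * V))); last by ring.
  congr (_ * _); rewrite /U /S /V !mulr_sumr -!big_split /=.
  by apply: eq_bigr => k _; ring.
have mQ : measurable_fun setT (fun w => expR (2 * lam * S * Z i w + lam * V * Z i w ^+ 2)).
  apply: measurable_expR_comp; apply: measurable_funD; first exact: measurable_scale.
  by apply/measurable_scale/measurable_funX.
have mN : measurable_fun setT (fun w => expR (lam * \sum_k (Z i w * v i k + u k) ^+ 2)).
  under eq_fun do rewrite expandE expRD; exact: measurable_scale.
apply: le_trans (ge0_integral_le_scale (b := expR (lam * U)) mN mQ _ _ _ _
  (expR_quadratic_moment_le (t0 i) (EZ2 i) (EZ i) _ lV0 _)) _ => //.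
- by move=> w; rewrite expandE expRD.
- by move: lb1; rewrite bE; lra.
have d0 : 0 < 1 - lam * beta i by lra.
have lb0 : 0 <= lam * beta i by rewrite mulr_ge0.
have h1 : 1 + lam * beta i <= (1 - lam * beta i)^-1.
  by rewrite -div1r ler_pdivlMr //; nra.
have h2 : expR (lam * beta i) <= (1 - lam * beta i)^-1.
  rewrite -[leLHS]invrK -expRN lef_pV2 ?posrE ?expR_gt0 //.
  exact: expR_ge1Dx.
rewrite lee_fin -expRD.
apply: (@le_trans _ _ (expR (lam * beta i) * expR (lam * (1 + lam * beta i) * U))).
  rewrite -expRD ler_expR.
  have SUV : S ^+ 2 <= V * U by exact: sumr_cauchy_schwarz.
  have := ler_wpM2l (mulr_ge0 (ler0n R 48) (mulr_ge0 (sqr_ge0 lam) (sqr_ge0 (t i)))) SUV.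
  rewrite !bE; nra.
apply: ler_pM; rewrite ?expR_ge0 // ler_expR.
by rewrite ler_wpM2r // ler_wpM2l.
Qed.

(** Induction with [lam] free, since removing a variable enlarges it. The factors telescope: [(1 -
    lam * beta m) * (1 - lam' * D) = 1 - lam * (beta m + D)]. *)
Lemma expR_norm_sqr_le (s : seq I) lam : uniq s -> 0 <= lam ->
  lam * \sum_(i <- s) beta i < 1 ->
  (\int[P]_w (expR (lam * \sum_k (\sum_(i <- s) Z i w * v i k) ^+ 2))%:E
   <= ((1 - lam * \sum_(i <- s) beta i)^-1)%:E)%E.
Proof.
elim: s lam => [|m s IH] lam /=.
  move=> _ lam0 _; rewrite (_ : (fun w => _) = fun=> 1%:E); last first.
    apply/funext => w; rewrite big1 ?mulr0 ?expR0 // => k _.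
    by rewrite big_nil expr0n.
  by rewrite integral_cst_probability big_nil mulr0 subr0 invr1.
move=> /andP[ms us] lam0; rewrite big_cons mulrDr; set D := \sum_(_ <- _) _ => lD.
have D0 : 0 <= D by apply: sumr_ge0.
have lb0 : 0 <= lam * beta m by rewrite mulr_ge0.
have lD0 : 0 <= lam * D by rewrite mulr_ge0.
have lb1 : lam * beta m < 1 by lra.
have d0 : 0 < 1 - lam * beta m by lra.
pose U k w := \sum_(i <- s) Z i w * v i k.
pose F (x : g_sigma_algebraType (cylinders Z m) * R) : \bar R :=
  (expR (lam * \sum_k (x.2 * v m k + U k x.1) ^+ 2))%:E.
have mF : measurable_fun setT F.
  apply/measurable_EFinP/measurable_expR_comp/measurable_scale.
  apply: measurable_sum => k; apply: measurable_funX; apply: measurable_funD.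
    by apply: measurable_funM => //; exact: measurable_snd.
  pose S : measurableType _ := g_sigma_algebraType (cylinders Z m).
  have mU : measurable_fun [set: S] (U k) by exact: measurable_sum_cylinders.
  have := @measurable_fun_comp_fst _ _ _ S R R (U k) mU.
  exact.
have EF w : (expR (lam * \sum_k (\sum_(i <- m :: s) Z i w * v i k) ^+ 2))%:E = F (w, Z m w).
  rewrite /F /=; congr (expR (_ * _))%:E.
  by apply: eq_bigr => k _; rewrite big_cons.
under eq_integral do rewrite EF.
set lam' := lam / (1 - lam * beta m).
have mU k : measurable_fun setT (U k : T -> R).
  by apply: measurable_sum => i; exact: measurable_funM.
have mN : measurable_fun [set: T] (fun w => expR (lam' * \sum_k U k w ^+ 2)).
  apply/measurable_expR_comp/measurable_scale.
  by apply: measurable_sum => k; exact: measurable_funX.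
pose H w := ((1 - lam * beta m)^-1 * expR (lam' * \sum_k U k w ^+ 2))%:E.
have mH : measurable_fun [set: T] H by exact/measurable_EFinP/measurable_scale.
apply: le_trans (mutually_independent_integral_le indep mF _ mH _) _.
- by move=> x; rewrite lee_fin expR_ge0.
- by move=> w; have := expR_norm_sqr_step (U ^~ w) lam0 lb1.
have lD' : lam' * D < 1 by rewrite /lam' mulrAC ltr_pdivrMr // mul1r; lra.
have lam'0 : 0 <= lam' by rewrite divr_ge0 // ltW.
apply: le_trans (ge0_integral_le_scale (P := P) (b := (1 - lam * beta m)^-1)
  (measurable_scale (1 - lam * beta m)^-1 mN) mN _ _ _ _ (IH lam' us lam'0 lD')) _.
- by move=> w; rewrite mulr_ge0 ?expR_ge0 // invr_ge0 ltW.
- by move=> w; rewrite expR_ge0.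
- by rewrite invr_ge0 ltW.
- by [].
rewrite lee_fin -invfM mulrBr mulr1.
have -> : (1 - lam * beta m) * (lam' * D) = lam * D.
  by rewrite /lam'; field; rewrite gt_eqF.
by rewrite opprD addrA.
Qed.

End hilbert_subgaussian.

(** * Combining sub-Gaussian variables in [l^p] *)

Lemma measurable_powR_comp d (T : measurableType d) (R : realType) (f : T -> R)
    (p : R) :
  measurable_fun setT f -> measurable_fun setT (fun w => f w `^ p).
Proof. exact: (measurableT_comp (measurable_powR p)). Qed.

(** With weights [b l ^ p / B] and [q = p / 2], the normalised square [u] satisfies [u ^ q =] the
    weighted mean of [(Y l ^+ 2 / b l ^+ 2) ^ q], so [expR_pmean] applies. The price [expR q] is
    removed by passing to the small multiple [th * u]. *)
Lemma integral_expR_sqr_lp_mean_le d (T : measurableType d) (R : realType)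
    (P : probability T R) (J : finType) (Y : J -> T -> R) (b : J -> R) (p : R) :
  1 <= p -> (forall l, measurable_fun setT (Y l)) -> (forall l w, 0 <= Y l w) ->
  (forall l, 0 < b l) -> (0 < #|J|)%N ->
  (forall l, (\int[P]_w (expR (Y l w ^+ 2 / b l ^+ 2))%:E <= 2%:E)%E) ->
  (\int[P]_w (expR (((\sum_l Y l w `^ p) `^ p^-1) ^+ 2 /
     (5 * p * ((\sum_l b l `^ p) `^ p^-1) ^+ 2)))%:E <= 2%:E)%E.
Proof.
move=> p1 mY Y0 b0 J0 EY; have p0 : 0 < p by lra.
set B := \sum_l b l `^ p.
have B0 : 0 < B.
  have /card_gt0P[l _] := J0.
  rewrite /B (bigD1 l) //= ltr_wpDr ?powR_gt0 //.
  by apply: sumr_ge0 => k _; rewrite powR_ge0.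
have [q qE] : exists q, q = p / 2 by exists (p / 2).
have q0 : 0 < q by rewrite qE; lra.
(* Chosen so that [th * q = 1 / 10] for every [p], while [th <= 1 / 5]. *)
pose th := (5 * p)^-1; have th0 : 0 < th by rewrite invr_gt0; lra.
have thq : th * q = 1 / 10 by rewrite /th qE; field; rewrite gt_eqF.
have th5 : th <= 1 / 5 by rewrite /th div1r lef_pV2 ?posrE; lra.
pose wt l := b l `^ p / B.
have wt0 l : 0 <= wt l by rewrite divr_ge0 ?powR_ge0 // ltW.
have wt1 : \sum_l wt l = 1 by rewrite -mulr_suml divff // gt_eqF.
pose X l w := expR (Y l w ^+ 2 / b l ^+ 2).
have mX l : measurable_fun setT (X l).
  by apply: measurable_expR_comp; apply: measurable_funM => //; exact: measurable_funX.
pose u w := ((\sum_l Y l w `^ p) `^ p^-1) ^+ 2 / (B `^ p^-1) ^+ 2.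
have mu : measurable_fun setT u.
  apply: measurable_funM => //; apply: measurable_funX.
  apply: measurable_powR_comp; apply: measurable_sum => l.
  exact: measurable_powR_comp.
have uE w : ((\sum_l Y l w `^ p) `^ p^-1) ^+ 2 / (5 * p * (B `^ p^-1) ^+ 2) = th * u w.
  by rewrite /u /th invfM mulrCA.
under eq_integral do rewrite uE.
have sqr_powR (x : R) : 0 <= x -> (x ^+ 2) `^ q = x `^ p.
  by move=> x0; rewrite -powR_mulrn // -powRrM qE mulrC divfK.
have Xle w : expR (u w) <= expR q + \sum_l wt l * X l w.
  apply: expR_pmean => // [|l|].
  - by rewrite divr_ge0 ?sqr_ge0.
  - by rewrite divr_ge0 ?sqr_ge0.
  have S0 : 0 <= \sum_l Y l w `^ p by apply: sumr_ge0 => l _; rewrite powR_ge0.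
  have uq : u w `^ q = (\sum_l Y l w `^ p) / B.
    rewrite /u powRM ?invr_ge0 ?sqr_ge0 // powR_inv ?sqr_ge0 //; congr (_ / _).
      by rewrite sqr_powR ?powR_ge0 // powR_powRV.
    by rewrite sqr_powR ?powR_ge0 // powR_powRV // ltW.
  rewrite uq mulr_suml.
  apply: eq_bigr => l _; rewrite /wt powRM ?invr_ge0 ?sqr_ge0 // powR_inv ?sqr_ge0 //.
  rewrite !sqr_powR ?(ltW (b0 _)) //.
  by field; rewrite !gt_eqF // powR_gt0.
have e0 := expR_gt0 q.
pose c l := expR (th * q) * th * expR (- q) * wt l.
have mth : measurable_fun setT (fun w => expR (th * u w)).
  exact/measurable_expR_comp/measurable_scale.
apply: le_trans (ge0_integral_le_affine (P := P) (a := expR (th * q)) (b := c)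
  (m := fun=> 2) mth mX _ _ _ _ _ EY) _.
- by move=> w; rewrite expR_ge0.
- by move=> l w; rewrite expR_ge0.
- by rewrite expR_ge0.
- by move=> l; rewrite /c mulr_ge0 // mulr_ge0 ?expR_ge0 // mulr_ge0 ?expR_ge0 // ltW.
- move=> w; rewrite -[X in _ <= X + _]mulr1.
  have -> : \sum_l c l * X l w
      = expR (th * q) * (th * (expR (- q) * \sum_l wt l * X l w)).
    rewrite mulr_sumr mulr_sumr mulr_sumr; apply: eq_bigr => l _.
    by rewrite /c; ring.
  rewrite -mulrDr.
  (* Centring at [q] before taking the chord turns [expR q] into 1 and discounts the weighted mean
     by [expR (- q)]. *)
  have -> : th * u w = th * q + th * (u w - q) by ring.
  rewrite expRD ler_wpM2l ?expR_ge0 //.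
  have := @expR_chord R th (u w - q).
  have -> : 0 <= th <= 1 by rewrite ltW //=; lra.
  move=> /(_ isT)/le_trans; apply.
  rewrite lerD2l ler_wpM2l ?(ltW th0) //.
  have := ler_wpM2l (expR_ge0 (- q)) (Xle w).
  rewrite mulrDr -!expRD addNr expR0 [- q + _]addrC; lra.
rewrite lee_fin -mulr_suml -mulr_sumr wt1 mulr1 thq.
have eq1 : expR (- q) <= 1 by rewrite -[leRHS]expR0 ler_expR; lra.
have h1 : th * expR (- q) * 2 <= 2 / 5.
  have := ler_wpM2l (ltW th0) eq1; lra.
(* The total exponent is [1 / 10 + 2 / 5 = 1 / 2], and [expR (1 / 2) <= 1 / (1 - 1 / 2) = 2]. *)
apply: (@le_trans _ _ (expR (1 / 10) * expR (2 / 5))).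
  have -> : expR (1 / 10) + expR (1 / 10) * th * expR (- q) * 2
    = expR (1 / 10) * (1 + th * expR (- q) * 2) by ring.
  rewrite ler_wpM2l ?expR_ge0 //.
  by have := expR_ge1Dx (2 / 5 : R); lra.
rewrite -expRD (_ : 1 / 10 + 2 / 5 = - - (1 / 2)); last by lra.
rewrite expRN -[leRHS]invrK lef_pV2 ?posrE ?expR_gt0 ?invr_gt0 //.
by have := expR_ge1Dx (- (1 / 2) : R); lra.
Qed.


(** * The smoothed discrete Fourier transform *)

Section dft_coordinates.
Context {R : realType} (L : R) (n : nat).
Hypothesis L0 : 0 < L.

Lemma sumr_Complex (J : finType) (f g : J -> R) :
  \sum_i Complex (f i) (g i) = Complex (\sum_i f i) (\sum_i g i).
Proof. by elim/big_rec3: _ => // i a b c _ ->. Qed.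

Lemma mul_real_complex (a x y : R) :
  real_complex R a * Complex x y = Complex (a * x) (a * y).
Proof. by apply/eqP; rewrite eq_complex /= !mul0r subr0 addr0 !eqxx. Qed.

Definition dft_phase (j m : 'I_n * 'I_n) : R :=
  - 2 * pi * ((freq m.1)%:~R * grid L j.1 + (freq m.2)%:~R * grid L j.2) / L.

(** The leading [L^-1] is the factor [L ^- 2] of [smooth_norm] brought inside the square. *)
Definition dft_weight (tau : R) (m : 'I_n * 'I_n) : R :=
  L^-1 * (L ^+ 2 / n%:R ^+ 2 * gauss_hat tau ((freq m.1)%:~R / L) ((freq m.2)%:~R / L)).

(* Real and imaginary parts of the contribution of the grid point [j] to the
   Fourier coefficient [m.1]. *)
Definition dft_coord (tau : R) (j : 'I_n * 'I_n) (m : ('I_n * 'I_n) * bool) : R :=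
  dft_weight tau m.1 *
  (if m.2 then cos (dft_phase j m.1) else sin (dft_phase j m.1)).

(** Real and imaginary parts give the form required by [expR_norm_sqr_le]: a real random combination
    of fixed real vectors. *)
Lemma smooth_norm_coord (x : 'I_n -> 'I_n -> R) (tau : R) :
  smooth_norm L (fun j1 j2 => real_complex R (x j1 j2)) tau ^+ 2
  = \sum_m (\sum_j x j.1 j.2 * dft_coord tau j m) ^+ 2.
Proof.
rewrite /smooth_norm sqr_sqrtr; last first.
  rewrite mulr_ge0 ?invr_ge0 ?sqr_ge0 //.
  by apply: sumr_ge0 => i _; apply: sumr_ge0 => k _; rewrite sqr_ge0.
rewrite pair_big /=.
rewrite -(pair_bigA _ (fun m b => (\sum_j x j.1 j.2 * dft_coord tau j (m, b)) ^+ 2)) /=.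
rewrite mulr_sumr; apply: eq_bigr => m _; rewrite big_bool /=.
have -> : dft_smooth L (fun j1 j2 => real_complex R (x j1 j2)) tau (freq m.1) (freq m.2)
    = Complex (L * \sum_j x j.1 j.2 * dft_coord tau j (m, true))
              (L * \sum_j x j.1 j.2 * dft_coord tau j (m, false)).
  rewrite /dft_smooth /dft pair_big /=.
  under eq_bigr do rewrite /cis mul_real_complex.
  rewrite sumr_Complex mul_real_complex mulrC mul_real_complex.
  congr Complex; rewrite !mulr_sumr; apply: eq_bigr => j _;
    rewrite /dft_coord /dft_weight /dft_phase /=; set u := gauss_hat _ _ _;
    set c := L ^+ 2 / _; by field; rewrite gt_eqF.
rewrite /ComplexField.Normc.normc sqr_sqrtr; last by rewrite addr_ge0 ?sqr_ge0.
by field; rewrite gt_eqF.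
Qed.

(** The phases disappear by [cos ^+ 2 + sin ^+ 2 = 1], so [j] is irrelevant. The squared Gaussian
    weight is dominated by a product over the two frequencies, and each one-dimensional sum is at
    most both [n] and [8 / b]. *)
Lemma dft_coord_norm_le (tau : R) (j : 'I_n * 'I_n) :
  (0 < n)%N -> 0 < tau -> Num.sqrt tau <= L ->
  \sum_m dft_coord tau j m ^+ 2
    <= 64 * L ^+ 2 / n%:R ^+ 2 * Num.min 1 (L / (n%:R * Num.sqrt tau)) ^+ 2.
Proof.
move=> n0 tau_gt0 sL; have N0 : 0 < n%:R :> R by rewrite ltr0n.
have st0 : 0 < Num.sqrt tau by rewrite sqrtr_gt0.
pose b := Num.sqrt tau / L.
have b01 : 0 < b <= 1 by rewrite divr_gt0 //= ler_pdivrMr // mul1r.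
have /andP[b0 b1] := b01.
pose g (m : 'I_n) := expR (- (b * (freq m)%:~R) ^+ 2).
have gauss_le m : gauss_hat tau ((freq m.1)%:~R / L) ((freq m.2)%:~R / L) ^+ 2
    <= g m.1 * g m.2.
  rewrite /gauss_hat /g -expRD expr2 -expRD ler_expR.
  have -> : b * (freq m.1)%:~R = Num.sqrt tau * ((freq m.1)%:~R / L) by rewrite /b; ring.
  have -> : b * (freq m.2)%:~R = Num.sqrt tau * ((freq m.2)%:~R / L) by rewrite /b; ring.
  rewrite !exprMn sqr_sqrtr ?(ltW tau_gt0) // -!exprMn.
  set A := (_ / L) ^+ 2 + _.
  have A0 : 0 <= A by rewrite addr_ge0 ?sqr_ge0.
  (* The constant [2 * pi ^+ 2] in the squared Gaussian is lowered to 1, the normalisation of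
     [gauss_sum_le]. *)
  have pi2 : 1 <= 2 * pi ^+ 2 :> R by have := @pi_ge2 R; nra.
  have : tau * A <= 2 * pi ^+ 2 * (tau * A) by rewrite ler_peMl // mulr_ge0 // ltW.
  rewrite /A; lra.
have g_sum : \sum_m g m <= 8 * (n%:R * Num.min 1 (L / (n%:R * Num.sqrt tau))).
  have h1 : \sum_m g m <= 8 / b by exact: gauss_sum_le.
  have h2 : \sum_m g m <= n%:R.
    apply: (@le_trans _ _ (\sum_(m < n) 1)); last by rewrite sumr_const card_ord.
    by apply: ler_sum => m _; rewrite -[leRHS]expR0 ler_expR oppr_le0 sqr_ge0.
  have [_|_] := leP 1 (L / (n%:R * Num.sqrt tau)); first by rewrite mulr1; lra.
  have -> : 8 * (n%:R * (L / (n%:R * Num.sqrt tau))) = 8 / b.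
    by rewrite /b; field; rewrite !gt_eqF.
  exact: h1.
rewrite -(pair_bigA _ (fun m b => dft_coord tau j (m, b) ^+ 2)) /=.
have coordE m : \sum_(b : bool) dft_coord tau j (m, b) ^+ 2 = dft_weight tau m ^+ 2.
  rewrite big_bool /dft_coord /= !exprMn -mulrDr cos2Dsin2 mulr1 //.
under eq_bigr do rewrite coordE.
apply: (@le_trans _ _ (\sum_m L ^+ 2 / n%:R ^+ 4 * (g m.1 * g m.2))).
  apply: ler_sum => m _; rewrite /dft_weight.
  set G := gauss_hat _ _ _; have := gauss_le m; rewrite -/G => HG.
  have -> : (L^-1 * (L ^+ 2 / n%:R ^+ 2 * G)) ^+ 2 = L ^+ 2 / n%:R ^+ 4 * G ^+ 2.
    by field; rewrite !gt_eqF.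
  by rewrite ler_wpM2l // divr_ge0 ?exprn_ge0 // ltW.
rewrite -mulr_sumr -(pair_bigA _ (fun m1 m2 => g m1 * g m2)) /=.
under eq_bigr do rewrite -mulr_sumr.
rewrite -mulr_suml -expr2.
set mu := Num.min 1 _ in g_sum *.
have mu0 : 0 <= mu by rewrite le_min ler01 divr_ge0 ?(ltW L0) // mulr_ge0 ?ltW.
apply: (@le_trans _ _ (L ^+ 2 / n%:R ^+ 4 * (8 * (n%:R * mu)) ^+ 2)).
  rewrite ler_wpM2l ?divr_ge0 ?exprn_ge0 ?(ltW L0) ?(ltW N0) //.
  rewrite lerXn2r // nnegrE ?mulr_ge0 ?(ltW N0) //.
  by apply: sumr_ge0 => m _; exact: expR_ge0.
rewrite le_eqVlt; apply/orP; left; apply/eqP.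
by field; rewrite gt_eqF.
Qed.

End dft_coordinates.

(** * The sub-Gaussian norm, and the smoothed norm at one level *)

Section psi2_norm_bounds.
Context d (T : measurableType d) (R : realType) (P : probability T R).

Lemma psi2_expectationE (X : T -> R) (t : R) :
  ('E_P[fun w => expR (`|X w| ^+ 2 / t ^+ 2)]
   = \int[P]_w (expR (X w ^+ 2 / t ^+ 2))%:E)%E.
Proof. by rewrite unlock; apply: eq_integral => w _; rewrite real_normK ?num_real. Qed.

Lemma psi2_norm_le (X : T -> R) (t : R) : 0 < t ->
  (\int[P]_w (expR (X w ^+ 2 / t ^+ 2))%:E <= 2%:E)%E -> (psi2_norm P X <= t%:E)%E.
Proof.
move=> t0 Xt; apply: ereal_inf_lbound; exists t => //; split => //.
by rewrite psi2_expectationE.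
Qed.

(** The slack [e] is needed because the infimum may fail to be attained: for [X = 0] it is 0, while
    [t] must be positive. *)
Lemma psi2_norm_lt (X : T -> R) (s e : R) : psi2_norm P X = s%:E -> 0 < e ->
  exists t, [/\ 0 < t, t < s + e &
    (\int[P]_w (expR (X w ^+ 2 / t ^+ 2))%:E <= 2%:E)%E].
Proof.
move=> Xs e0; have : (psi2_norm P X < (s + e)%:E)%E by rewrite Xs lte_fin ltrDl.
move=> /ereal_inf_lt[_ [t [t0 tX] <-]]; rewrite lte_fin => ts.
by exists t; split => //; rewrite -psi2_expectationE.
Qed.

End psi2_norm_bounds.

Section smooth_norm_subgaussian.
Context {R : realType} (L : R) (n : nat).
Hypothesis L0 : 0 < L.
Hypothesis n0 : (0 < n)%N.
Context d (T : measurableType d) (P : probability T R).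
Variables (Z : 'I_n -> 'I_n -> {RV P >-> R}) (sigmaZ : 'I_n -> 'I_n -> R) (sigma : R).
Hypothesis indep : mutually_independent (fun j : 'I_n * 'I_n => Z j.1 j.2).
Hypothesis EZ : forall j1 j2, ('E_P[Z j1 j2] = 0)%E.
Hypothesis psi2Z : forall j1 j2, psi2_norm P (Z j1 j2) = (sigmaZ j1 j2)%:E.
Hypothesis sigma0 : 0 < sigma.
Hypothesis sigmaZ_le :
  n%:R ^- 2 * (\sum_(j1 < n) \sum_(j2 < n) sigmaZ j1 j2 ^+ 2) <= sigma ^+ 2.

Let S tau w := smooth_norm L (fun j1 j2 => real_complex R (Z j1 j2 w)) tau.

Lemma smooth_norm_moment_le tau : 0 < tau -> Num.sqrt tau <= L ->
  (\int[P]_w (expR (S tau w ^+ 2 /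
     (160 * L * sigma * Num.min 1 (L / (n%:R * Num.sqrt tau))) ^+ 2))%:E <= 2%:E)%E.
Proof.
move=> tau0 tauL; have N0 : 0 < n%:R :> R by rewrite ltr0n.
set mu := Num.min 1 _.
have mu0 : 0 < mu by rewrite lt_min ltr01 divr_gt0 // mulr_gt0 // sqrtr_gt0.
(* The slack is [sigma], so that the sum of the [t j ^+ 2] is still of order [n ^ 2 * sigma ^ 2]. *)
have /choice[t tP] : forall j : 'I_n * 'I_n, exists t, [/\ 0 < t, t < sigmaZ j.1 j.2 + sigma &
    (\int[P]_w (expR (Z j.1 j.2 w ^+ 2 / t ^+ 2))%:E <= 2%:E)%E].
  by move=> j; exact: psi2_norm_lt.
pose lam := (160 * L * sigma * mu) ^- 2.
have K0 : 0 < 160 * L * sigma * mu by rewrite !mulr_gt0.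
have lam0 : 0 <= lam by rewrite invr_ge0 sqr_ge0.
have sum_t : \sum_j t j ^+ 2 <= 4 * n%:R ^+ 2 * sigma ^+ 2.
  apply: (@le_trans _ _ (\sum_j (2 * sigmaZ j.1 j.2 ^+ 2 + 2 * sigma ^+ 2))).
    apply: ler_sum => j _; have [tj0 tj _] := tP j.
    apply: (@le_trans _ _ ((sigmaZ j.1 j.2 + sigma) ^+ 2)).
      by rewrite lerXn2r ?nnegrE ?(ltW tj) // ltW // (lt_trans tj0).
    by have := sqr_ge0 (sigmaZ j.1 j.2 - sigma); lra.
  rewrite big_split /= -mulr_sumr sumr_const card_prod card_ord.
  rewrite -(pair_bigA _ (fun j1 j2 => sigmaZ j1 j2 ^+ 2)) /=.
  move: sigmaZ_le; rewrite mulrC ler_pdivrMr ?exprn_gt0 //.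
  set Q := \sum_(_ < _) _ => HQ.
  rewrite -(mulr_natr (2 * sigma ^+ 2)) natrM; lra.
pose v := dft_coord L tau (n := n).
have v_le j := dft_coord_norm_le L0 j n0 tau0 tauL.
(* Here [48 * 64 * 4 = 12288], and [160 ^ 2 = 25600] exceeds twice that, whence the bound 1/2 and a
   final moment at most 2. *)
have D_le : lam * \sum_j 48 * (t j ^+ 2 * \sum_m v j m ^+ 2) <= 1 / 2.
  apply: (@le_trans _ _ (lam * (48 * (64 * L ^+ 2 / n%:R ^+ 2 * mu ^+ 2) * (4 * n%:R ^+ 2 * sigma ^+ 2)))).
    rewrite ler_wpM2l //.
    apply: (@le_trans _ _ (48 * (64 * L ^+ 2 / n%:R ^+ 2 * mu ^+ 2) * \sum_j t j ^+ 2)).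
      rewrite mulr_sumr; apply: ler_sum => j _; rewrite mulrCA [leRHS]mulrC.
      rewrite ler_wpM2l ?sqr_ge0 // ler_wpM2l //; exact: v_le.
    rewrite ler_wpM2l // mulr_ge0 // mulr_ge0 ?sqr_ge0 // divr_ge0 ?sqr_ge0 //.
    by rewrite mulr_ge0 ?sqr_ge0.
  rewrite /lam mulrC ler_pdivrMr ?exprn_gt0 // !exprMn.
  have -> : 48 * (64 * L ^+ 2 / n%:R ^+ 2 * mu ^+ 2) * (4 * n%:R ^+ 2 * sigma ^+ 2)
     = 12288 * (L ^+ 2 * sigma ^+ 2 * mu ^+ 2).
    by field; rewrite gt_eqF.
  have : 0 <= L ^+ 2 * sigma ^+ 2 * mu ^+ 2 by rewrite -!exprMn sqr_ge0.
  lra.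
have SE w : expR (S tau w ^+ 2 / (160 * L * sigma * mu) ^+ 2)
    = expR (lam * \sum_m (\sum_j Z j.1 j.2 w * v j m) ^+ 2).
  by rewrite /S (smooth_norm_coord L0 (fun j1 j2 => Z j1 j2 w)) mulrC.
under eq_integral do rewrite SE.
have t_gt0 j : 0 < t j by case: (tP j).
have tZ j : (\int[P]_w (expR (Z j.1 j.2 w ^+ 2 / t j ^+ 2))%:E <= 2%:E)%E by case: (tP j).
have lD1 : lam * \sum_j 48 * (t j ^+ 2 * \sum_m v j m ^+ 2) < 1.
  by apply: le_lt_trans D_le _; lra.
have H := expR_norm_sqr_le indep t_gt0 (fun j => EZ j.1 j.2) tZ
  (index_enum_uniq _) lam0 lD1.
apply: le_trans H _.
rewrite lee_fin -[leRHS]invrK lef_pV2 ?posrE ?invr_gt0 //; last lra.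
by lra.
Qed.
End smooth_norm_subgaussian.

Lemma measurable_smooth_norm d (T : measurableType d) (R : realType) (L : R)
    (n : nat) (X : 'I_n -> 'I_n -> T -> R) (tau : R) :
  0 < L -> (forall j1 j2, measurable_fun setT (X j1 j2)) ->
  measurable_fun setT
    (fun w => smooth_norm L (fun j1 j2 => real_complex R (X j1 j2 w)) tau).
Proof.
(* The square root is written as the power [1 / 2], to which measurability of powers applies. *)
move=> L0 mX; rewrite (_ : (fun w => _) = fun w =>
    (\sum_m (\sum_j X j.1 j.2 w * dft_coord L tau j m) ^+ 2) `^ 2^-1).
  apply: measurable_powR_comp; apply: measurable_sum => m; apply: measurable_funX.
  by apply: measurable_sum => j; exact: measurable_funM.
apply/funext => w; rewrite -(smooth_norm_coord L0 (fun j1 j2 => X j1 j2 w)).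
by rewrite powR12_sqrt ?sqr_ge0 // sqrtr_sqr ger0_norm // sqrtr_ge0.
Qed.

(** * Assembling the levels *)

Theorem theorem6p1 (R : realType) :
  exists C : R, 0 < C /\
  forall (alpha p tau0 omega L : R) (n M : nat),
    0 < alpha -> 1 <= p -> 0 < tau0 -> 0 < omega -> omega < 1 ->
    0 < L -> Num.sqrt tau0 <= L ->
    (0 < n)%N -> ~~ odd n -> L / (n%:R * Num.sqrt tau0) < 1 ->
  forall (d : measure_display) (T : measurableType d) (P : probability T R)
    (Z : 'I_n -> 'I_n -> {RV P >-> R}) (sigmaZ : 'I_n -> 'I_n -> R)
    (sigma : R),
    mutually_independent (fun j : 'I_n * 'I_n => Z j.1 j.2) ->
    (forall j1 j2, ('E_P[Z j1 j2] = 0)%E) ->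
    (forall j1 j2, psi2_norm P (Z j1 j2) = (sigmaZ j1 j2)%:E) ->
    0 < sigma ->
    n%:R ^- 2 * (\sum_(j1 < n) \sum_(j2 < n) sigmaZ j1 j2 ^+ 2)
      <= sigma ^+ 2 ->
  let Pi (w : T) : R :=
    gamma_norm L p alpha tau0 omega M
      (fun j1 j2 => real_complex R (Z j1 j2 w)) in
  (psi2_norm P Pi <=
    (C * (tau0 `^ (alpha / 2) / (1 - omega `^ 2^-1)) * L * Num.sqrt p * sigma
      * Delta alpha p (L / (n%:R * Num.sqrt tau0)))%:E)%E.
Proof.
(* The proof produces [160 * 2 * 3 = 960]: 160 from one level, 2 from the level sum, and 3 as a
   bound for [sqrt 5]. *)
exists 1000; split; first exact: ltr0Sn.
move=> alpha p tau0 omega L n M a0 p1 t00 om0 om1 L0 tL n0 _ e1.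
move=> d T P Z sigmaZ sigma indep EZ psi2Z s0 sle; cbv zeta.
set Pi := (X in psi2_norm P X).
have p0 : 0 < p by lra.
have N0 : 0 < n%:R :> R by rewrite ltr0n.
have st0 : 0 < Num.sqrt tau0 by rewrite sqrtr_gt0.
set eps := L / _ in e1 *.
have eps0 : 0 < eps by rewrite divr_gt0 // mulr_gt0.
have eps01 : 0 < eps < 1 by rewrite eps0.
rewrite (powR12_sqrt (ltW om0)); set r := Num.sqrt omega.
have r0 : 0 < r by rewrite sqrtr_gt0.
have rE : omega = r ^+ 2 by rewrite sqr_sqrtr // ltW.
have r1 : r < 1 by rewrite -[ltRHS]sqrtr1 ltr_sqrt.
have r01 : 0 < r < 1 by rewrite r0.
have rl0 l : 0 < r ^+ l by rewrite exprn_gt0.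
pose tau l := tau0 * omega ^+ l.
have tau_gt0 l : 0 < tau l by rewrite mulr_gt0 // exprn_gt0.
have tauE l : tau l = tau0 * (r ^+ l) ^+ 2 by rewrite /tau rE exprAC.
have sqrt_tau l : Num.sqrt (tau l) = Num.sqrt tau0 * r ^+ l.
  by rewrite tauE sqrtrM ?(ltW t00) // sqrtr_sqr ger0_norm // ltW.
have tauL l : Num.sqrt (tau l) <= L.
  apply: le_trans tL; rewrite sqrt_tau ler_piMr ?(ltW st0) //.
  by rewrite exprn_ile1 ?(ltW r0) ?(ltW r1).
have tauA l : tau l `^ (alpha / 2) = tau0 `^ (alpha / 2) * (r ^+ l) `^ alpha.
  rewrite tauE powRM ?(ltW t00) ?sqr_ge0 //; congr (_ * _).
  by rewrite -powR_mulrn ?(ltW (rl0 l)) // -powRrM mulrC divfK.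
have ta0 l : 0 < tau l `^ (alpha / 2) by rewrite powR_gt0.
pose S l w := smooth_norm L (fun j1 j2 => real_complex R (Z j1 j2 w)) (tau l).
pose K l := 160 * L * sigma * Num.min 1 (L / (n%:R * Num.sqrt (tau l))).
have epsE l : L / (n%:R * Num.sqrt (tau l)) = eps / r ^+ l.
  by rewrite /eps sqrt_tau; field; rewrite !gt_eqF.
have K0 l : 0 < K l.
  by rewrite /K epsE !mulr_gt0 // lt_min ltr01 divr_gt0.
(* The level weights multiply both the variables and their sub-Gaussian bounds, so [Y l / b l] is
   the unweighted ratio [S l / K l]. *)
pose Y (l : 'I_M.+1) w := tau l `^ (alpha / 2) * S l w.
pose b (l : 'I_M.+1) := tau l `^ (alpha / 2) * K l.
have b0 l : 0 < b l by rewrite mulr_gt0.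
have Y0 l w : 0 <= Y l w by rewrite mulr_ge0 ?(ltW (ta0 _)) // sqrtr_ge0.
have PiE w : Pi w = (\sum_l Y l w `^ p) `^ p^-1.
  rewrite /Pi /gamma_norm; congr (_ `^ _); apply: eq_bigr => l _.
  rewrite /Y [in RHS]powRM ?(ltW (ta0 _)) ?sqrtr_ge0 // -powRrM.
  by congr (_ `^ _ * _); ring.
have mY l : measurable_fun setT (Y l).
  apply: measurable_scale.
  by apply: (@measurable_smooth_norm _ _ _ _ _ (fun j1 j2 => Z j1 j2)).
have EY l : (\int[P]_w (expR (Y l w ^+ 2 / b l ^+ 2))%:E <= 2%:E)%E.
  have YE w : expR (Y l w ^+ 2 / b l ^+ 2) = expR (S l w ^+ 2 / K l ^+ 2).
    by congr expR; rewrite /Y /b; field; rewrite !gt_eqF.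
  under eq_integral do rewrite YE.
  exact: (smooth_norm_moment_le L0 n0 indep EZ psi2Z s0 sle (tau_gt0 l) (tauL l)).
set B := (\sum_l b l `^ p) `^ p^-1.
have B0 : 0 < B.
  rewrite powR_gt0 // (bigD1 ord0) //= ltr_wpDr ?powR_gt0 //.
  by apply: sumr_ge0 => l _; rewrite powR_ge0.
have J0 : (0 < #|'I_M.+1|)%N by rewrite card_ord.
have EPi := integral_expR_sqr_lp_mean_le p1 mY Y0 b0 J0 EY.
have t0 : 0 < Num.sqrt (5 * p) * B by rewrite mulr_gt0 // sqrtr_gt0; lra.
apply: (@le_trans _ _ (Num.sqrt (5 * p) * B)%:E).
  have tE : (Num.sqrt (5 * p) * B) ^+ 2 = 5 * p * B ^+ 2.
    by rewrite exprMn sqr_sqrtr // mulr_ge0 // ltW.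
  apply: (psi2_norm_le t0); rewrite tE.
  by under eq_integral do rewrite PiE.
rewrite lee_fin.
pose c := 160 * L * sigma * tau0 `^ (alpha / 2).
have c0 : 0 < c by rewrite !mulr_gt0 // powR_gt0.
(* Since [sqrt (tau l) = sqrt tau0 * r ^+ l], all dependence on the level lies in the summand of
   [level_sum_le]; the remaining factors come out by homogeneity. *)
have BE : B = c * (\sum_(l < M.+1) ((r ^+ l) `^ alpha * Num.min 1 (eps / r ^+ l)) `^ p) `^ p^-1.
  have m0 l : 0 <= (r ^+ l) `^ alpha * Num.min 1 (eps / r ^+ l).
    by rewrite mulr_ge0 ?powR_ge0 // le_min ler01 divr_ge0 // ltW.
  have -> : c = (c `^ p) `^ p^-1 by rewrite -powRrM divff ?gt_eqF // powRr1 // ltW.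
  rewrite -powRM ?powR_ge0 //; last by apply: sumr_ge0 => l _; rewrite powR_ge0.
  rewrite mulr_sumr; congr (_ `^ _); apply: eq_bigr => l _.
  rewrite -powRM ?(ltW c0) //; congr (_ `^ _).
  by rewrite /b /K epsE tauA /c; ring.
have D0 := Delta_ge0 p a0 eps01.
have B_le : B <= c * (2 / (1 - r) * Delta alpha p eps).
  by rewrite BE ler_wpM2l ?(ltW c0) // level_sum_le.
have s5 : Num.sqrt (5 * p) <= 3 * Num.sqrt p.
  rewrite sqrtrM // ler_wpM2r ?sqrtr_ge0 //.
  have -> : 3 = Num.sqrt (3 ^+ 2) :> R by rewrite sqrtr_sqr ger0_norm.
  by rewrite ler_sqrt //; lra.
apply: le_trans (ler_pM (sqrtr_ge0 _) (ltW B0) s5 B_le) _.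
have d0 : 0 < 1 - r by lra.
have : 0 <= tau0 `^ (alpha / 2) / (1 - r) * L * Num.sqrt p * sigma * Delta alpha p eps.
  rewrite mulr_ge0 // mulr_ge0 ?(ltW s0) // mulr_ge0 ?sqrtr_ge0 //.
  by rewrite mulr_ge0 ?(ltW L0) // divr_ge0 ?powR_ge0 // ltW.
rewrite /c; lra.
Qed.
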